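(* Let $(W,S)$ be a Coxeter system, let $T\subseteq S$ be a spherical subset with $|T|=k$, and let $\mathbf{q}=(q_s)_{s\in S}$ be a multiparameter of positive reals (with $q_s=q_{s'}$ whenever $s,s'$ are conjugate) such that $\mathbf{q}\in\mathcal{R}_{\mathrm{St}(T)}$. Then the reduced weighted $L^2$-homology $L^2_\mathbf{q}H_i(\Omega(S,T),\partial\Omega(S,T))$ vanishes for all $i\neq k$.
   Context: A Coxeter system $(W,S)$: $W$ is generated by $S$ with relations $(st)^{m_{st}}=1$ for $m_{st}<\infty$, $m_{ss}=1$, $m_{st}\ge 2$ for $s\ne t$. For $U\subseteq S$, $W_U$ is the subgroup generated by $U$; $U$ is spherical if $W_U$ is finite; $\mathcal{S}$ is the poset of spherical subsets. For $w\in W$ with reduced expression $s_1\cdots s_n$, $q_w=q_{s_1}\cdots q_{s_n}$. The growth series of $W_U$ is $W_U(\mathbf{t})=\sum_{w\in W_U}t_w$, and $\mathcal{R}_U=\{\mathbf{t}\in(0,\infty)^S: W_U(\mathbf{t})\text{ converges}\}$. For spherical $T$, $\mathrm{St}(T)=\bigcup\{U\subseteq S: U\cup T\in\mathcal{S}\}$. The Davis complex $\Sigma$ is given its Coxeter cellulation $\Sigma_{cc}$: its cells are the translates $wc_U$ ($w\in W$, $U\in\mathcal{S}$), where $c_U$ is the Coxeter cell of type $U$ (a cell whose boundary is the Coxeter complex of the finite group $W_U$); the cell poset is $\{wW_U: w\in W, U\in\mathcal{S}\}$. The $(S,T)$-ruin: $\Omega(S,T)$ is the union of closed Coxeter cells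 of type $T'$ with $T'\in\mathcal{S}$, $T'\supseteq T$; $\partial\Omega(S,T)$ is the subcomplex of cells of $\Omega(S,T)$ whose type does not contain $T$. Weighted $L^2$-homology: for a $W$-CW complex $\mathcal{U}$ of this form, a cell $w\sigma$ (with $\sigma$ a cell of the fundamental chamber having stabilizer type $S(\sigma)$) gets measure $\mu_\mathbf{q}(w\sigma)=q_u$ where $u$ is the shortest element of $wW_{S(\sigma)}$; $L^2_\mathbf{q}C_i$ is the Hilbert space of $i$-chains square-summable w.r.t. $\langle f,g\rangle_\mathbf{q}=\sum_\sigma f(\sigma)g(\sigma)\mu_\mathbf{q}(\sigma)$; the boundary $\partial^\mathbf{q}$ is the adjoint of the usual coboundary $\delta$ with respect to this inner product, and reduced homology is $L^2_\mathbf{q}H_i=\ker\partial^\mathbf{q}_i/\overline{\operatorname{im}\partial^\mathbf{q}_{i+1}}$ (relative versions for pairs are defined analogously). *)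

(* Defs.v *)
From HB Require Import structures.
From mathcomp Require Import all_boot all_order all_algebra.
From mathcomp Require Import all_classical all_reals.
From mathcomp Require Import esum.
Set Implicit Arguments. Unset Strict Implicit. Unset Printing Implicit Defensive.
Import Order.TTheory GRing.Theory Num.Theory.
Local Open Scope classical_set_scope.
Local Open Scope ring_scope.

(* A Coxeter matrix on the finite set S; m s t = 0 encodes m_st = infinity. *)
Definition coxeter_matrix (S : finType) (m : S -> S -> nat) : Prop :=
  (forall s, m s s = 1%N) /\ (forall s t, m s t = m t s) /\
  (forall s t, s != t -> m s t != 1%N).

Definition relator (S : finType) (m : S -> S -> nat) (r : seq S) : Prop :=
  exists s t, (0 < m s t)%N /\ r = flatten (nseq (m s t) [:: s; t]).

(* Equality in W of the elements represented by two words: the congruence on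
   the free monoid generated by r = 1 for the relators r.  (Since s s = 1 is a
   relator, this monoid is the Coxeter group W.) *)
Inductive coxeq (S : finType) (m : S -> S -> nat) : seq S -> seq S -> Prop :=
| coxeq_refl w : coxeq m w w
| coxeq_sym w1 w2 : coxeq m w1 w2 -> coxeq m w2 w1
| coxeq_trans w1 w2 w3 : coxeq m w1 w2 -> coxeq m w2 w3 -> coxeq m w1 w3
| coxeq_ins a b r : relator m r -> coxeq m (a ++ b) (a ++ r ++ b).

Definition in_coset (S : finType) (m : S -> S -> nat) (U : {set S})
  (w w' : seq S) : Prop :=
  exists u, all (mem U) u /\ coxeq m (w ++ u) w'.

Definition inW (S : finType) (m : S -> S -> nat) (V : {set S}) (w : seq S) : Prop :=
  exists v, all (mem V) v /\ coxeq m v w.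

Fixpoint lexle (S : finType) (w w' : seq S) : bool :=
  match w, w' with
  | [::], _ => true
  | _ :: _, [::] => false
  | a :: w1, b :: w2 =>
      (enum_rank a < enum_rank b)%N || ((a == b) && lexle w1 w2)
  end.

Definition shortlex_le (S : finType) (w w' : seq S) : bool :=
  (size w < size w')%N || ((size w == size w') && lexle w w').

(* w is the canonical (shortlex-least) word of the coset w W_U.  It is a
   reduced word for the shortest element of the coset. *)
Definition canon (S : finType) (m : S -> S -> nat) (U : {set S}) (w : seq S) : Prop :=
  forall w', in_coset m U w w' -> shortlex_le w w'.

Definition crep (S : finType) (m : S -> S -> nat) (U : {set S}) (w : seq S) : seq S :=
  xget [::] [set c | canon m U c /\ in_coset m U w c].

(* U is spherical: W_U is finite (elements of W represented by the canonical
   words of the cosets of the trivial subgroup). *)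
Definition spherical (S : finType) (m : S -> S -> nat) (U : {set S}) : Prop :=
  finite_set [set w | canon m (finset.set0 : {set S}) w /\ inW m U w].

Definition St (S : finType) (m : S -> S -> nat) (T : {set S}) : {set S} :=
  finset (fun s => `[< exists U : {set S}, s \in U /\ spherical m (U :|: T) >]).

Definition qw (R : realType) (S : finType) (q : S -> R) (w : seq S) : R :=
  \prod_(s <- w) q s.

Definition in_region (R : realType) (S : finType) (m : S -> S -> nat)
  (q : S -> R) (V : {set S}) : Prop :=
  (\esum_(w in [set w | canon m (finset.set0 : {set S}) w /\ inW m V w]) (qw q w)%:E < +oo)%E.

(* Cells of Omega(S,T) not in dOmega(S,T): the cosets w W_U with U spherical,
   T \subset U; represented by (U, canonical word of the coset).  Dimension |U|. *)
Definition relcell (S : finType) (m : S -> S -> nat) (T : {set S}) (i : nat)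
  : set ({set S} * seq S) :=
  [set c : {set S} * seq S | [/\ T \subset c.1, spherical m c.1, #|c.1| = i & canon m c.1 c.2]].

(* Orientation sign of the face c_{V - s} in the boundary of the Coxeter cell c_V. *)
Definition eps (R : realType) (S : finType) (s : S) (V : {set S}) : R :=
  (-1) ^+ #|finset (fun t => (t \in V) && (enum_rank t < enum_rank s)%N)|.

Definition wnorm2 (R : realType) (S : finType) (m : S -> S -> nat) (q : S -> R)
  (T : {set S}) (i : nat) (f : {set S} -> seq S -> R) : \bar R :=
  \esum_(c in relcell m T i) ((f c.1 c.2) ^+ 2 * qw q c.2)%:E.

Definition L2chain (R : realType) (S : finType) (m : S -> S -> nat) (q : S -> R)
  (T : {set S}) (i : nat) (f : {set S} -> seq S -> R) : Prop :=
  (wnorm2 m q T i f < +oo)%E.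

(* The weighted boundary d^q, adjoint of the cellular coboundary w.r.t. the
   weighted inner product:  (d^q f)(tau) = mu(tau)^-1 sum_{sigma > tau}
   [sigma : tau] mu(sigma) f(sigma), where for tau = w W_U the cofaces are
   sigma = w W_{U+s} (s \notin U, U+s spherical) and, with canonical words,
   [sigma : tau] = eps(s, U+s) (-1)^(l(w) - l(sigma_min)). *)
Definition dq (R : realType) (S : finType) (m : S -> S -> nat) (q : S -> R)
  (f : {set S} -> seq S -> R) (U : {set S}) (w : seq S) : R :=
  (qw q w)^-1 *
  \sum_(s : S | (s \notin U) && `[< spherical m (s |: U) >])
     (eps R s (s |: U) * (-1) ^+ (size w - size (crep m (s |: U) w))%N *
      qw q (crep m (s |: U) w) * f (s |: U) (crep m (s |: U) w)).

(* Vanishing of the reduced weighted L^2-homology in degree i: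
   ker d^q_i = closure (im d^q_{i+1}) in L^2_q C_i(Omega, dOmega). *)
Definition L2H_vanishes (R : realType) (S : finType) (m : S -> S -> nat)
  (q : S -> R) (T : {set S}) (i : nat) : Prop :=
  forall f : {set S} -> seq S -> R,
    L2chain m q T i f ->
    (forall c, relcell m T i.-1 c -> (0 < i)%N -> dq m q f c.1 c.2 = 0) ->
    forall e : R, 0 < e ->
      exists g : {set S} -> seq S -> R,
        L2chain m q T i.+1 g /\
        (wnorm2 m q T i (fun U w => (dq m q g U w - f U w)%R) < e%:E)%E.

(* Main.v *)
From HB Require Import structures.
From mathcomp Require Import all_boot all_order all_algebra.
From mathcomp Require Import all_classical all_reals.
From mathcomp Require Import finmap ereal esum.
From mathcomp Require Import zify ring lra.
Require Import Defs.
Import Order.TTheory GRing.Theory Num.Theory.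
Set Implicit Arguments. Unset Strict Implicit. Unset Printing Implicit Defensive.

(* A chain [f] of degree [i] is encoded by the functions
   [c_U(x) = (-1)^l(a) q_a f(U, a)], with [a] the shortest element of [x W_U].
   They are right [W_U]-invariant functions on the Coxeter group [W], square
   summable for the weight [1/q]; the weighted boundary becomes the alternating
   sum of the inclusions of the spaces of [W_(U+s)]-invariant functions into
   the spaces of [W_U]-invariant functions.

   For finitely supported functions this complex is exact in degrees [> |T|]:
   if [x] is a longest element of the support of [c_U], then [U] is contained in
   the descent set of [x], which is spherical, and the part of the complex
   carried by [x] is an augmented simplicial chain complex.

   It remains to approximate cycles by finitely supported cycles. Let [V = St T]
   and let [rho_n] fold [W_V] onto a finite set: as long as [x] is separated from
   1 by a reflection of length [> n], replace [x] by [r x], where [r] is the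
   largest inversion of [x] (by length, then lexicographically). Then
   [rho_n(x s)] is [rho_n(x)] or [rho_n(x) s], so that the signed push-forward of
   functions along [rho_n] preserves right invariance and hence cycles. A rank
   two argument shows that [r x] is a prefix of [x]; hence [rho_n(x)] is a prefix
   of [x], the fibre over [y] has mass at most [q_y W_V(q)], and by
   Cauchy-Schwarz the push-forwards are uniformly bounded. They converge to the
   identity because [rho_n] fixes the elements of small length. *)

(** * Words modulo the Coxeter relations, and the group they form *)

Section CoxeterGroup.
Variables (S : finType) (m : S -> S -> nat).

Lemma coxeq_cat u u' v v' :
  coxeq m u u' -> coxeq m v v' -> coxeq m (u ++ v) (u' ++ v').
Proof.
move=> uu' vv'; apply: (@coxeq_trans _ _ _ (u' ++ v)).
  elim: uu' => {u u'} [w|w w' _ h|w1 w2 w3 _ h _ h'|a b r rr].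
  - exact: coxeq_refl.
  - exact: coxeq_sym.
  - exact: coxeq_trans h h'.
  - by rewrite -!catA; exact: coxeq_ins.
elim: vv' => {v v'} [w|w w' _ h|w1 w2 w3 _ h _ h'|a b r rr].
- exact: coxeq_refl.
- exact: coxeq_sym.
- exact: coxeq_trans h h'.
- by rewrite !(catA u'); exact: coxeq_ins.
Qed.

Hypothesis mP : coxeter_matrix m.

Lemma coxeq_ss s : coxeq m [:: s; s] [::].
Proof.
apply/coxeq_sym/(@coxeq_ins _ m [::] [::] [:: s; s]).
by exists s, s; rewrite mP.1.
Qed.

(** The reversal of the relator of [s] and [t] is the relator of [t] and [s]. As generators are
    involutions, reversal represents inversion. *)
Lemma coxeq_rev u v : coxeq m u v -> coxeq m (rev u) (rev v).
Proof.
elim=> {u v} [w|w w' _ h|w1 w2 w3 _ h _ h'|a b r [s [t [mst ->]]]].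
- exact: coxeq_refl.
- exact: coxeq_sym.
- exact: coxeq_trans h h'.
- rewrite !rev_cat -catA; apply: coxeq_ins; exists t, s.
  rewrite mP.2.1; split=> //; move: (m s t) => k {mst}.
  elim: k => //= k IH; rewrite !rev_cons IH -cats1 -cats1 -catA /=.
  elim: k {IH} => //= k IH; congr [:: _, _ & _]; exact: IH.
Qed.

Lemma coxeq_revr w : coxeq m (w ++ rev w) [::].
Proof.
elim: w => [|s w IH]; first exact: coxeq_refl.
rewrite rev_cons -cats1 -cat1s -catA (catA w).
apply: (@coxeq_trans _ _ _ ([:: s] ++ [::] ++ [:: s])); last exact: coxeq_ss.
apply: coxeq_cat; first exact: coxeq_refl.
by apply: coxeq_cat => //; exact: coxeq_refl.
Qed.

Definition coxeqb : rel (seq S) := fun u v => `[< coxeq m u v >].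

Lemma coxeqb_refl : reflexive coxeqb.
Proof. by move=> w; apply/asboolP/coxeq_refl. Qed.
Lemma coxeqb_sym : symmetric coxeqb.
Proof. by move=> u v; apply/asboolP/asboolP => /coxeq_sym. Qed.
Lemma coxeqb_trans : transitive coxeqb.
Proof.
by move=> v u w /asboolP uv /asboolP vw; apply/asboolP; exact: coxeq_trans uv vw.
Qed.
Canonical coxeqb_equiv := EquivRel coxeqb coxeqb_refl coxeqb_sym coxeqb_trans.

End CoxeterGroup.

(* The type depends on the proof [mP], which its group structure needs. *)
Definition coxgroup (S : finType) (m : S -> S -> nat) (mP : coxeter_matrix m) :=
  {eq_quot (coxeqb m)}%qT.
HB.instance Definition _ (S : finType) (m : S -> S -> nat)
  (mP : coxeter_matrix m) := Choice.on (coxgroup mP).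

Section CoxeterGroupStructure.
Variables (S : finType) (m : S -> S -> nat) (mP : coxeter_matrix m).
Local Notation G := (coxgroup mP).

Definition wd (w : seq S) : G := \pi_({eq_quot (coxeqb m)})%qT w.
Definition word (x : G) : seq S := repr (x : {eq_quot (coxeqb m)}%qT).

Lemma wordK x : wd (word x) = x. Proof. exact: reprK. Qed.

Lemma wdE u v : wd u = wd v <-> coxeq m u v.
Proof. by split=> [/eqmodP/asboolP|h] //; apply/eqmodP/asboolP. Qed.

Lemma word_wd w : coxeq m (word (wd w)) w.
Proof. by apply/wdE; rewrite wordK. Qed.

Definition cox_mul (x y : G) : G := wd (word x ++ word y).
Definition cox_inv (x : G) : G := wd (rev (word x)).

Lemma cox_mulA : associative cox_mul.
Proof.
move=> x y z; apply/wdE.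
apply: (@coxeq_trans _ _ _ (word x ++ word y ++ word z)).
  by apply: coxeq_cat; [exact: coxeq_refl | exact: word_wd].
rewrite catA; apply: coxeq_cat; last exact: coxeq_refl.
exact/coxeq_sym/word_wd.
Qed.

Lemma cox_mul1 : left_id (wd [::]) cox_mul.
Proof.
move=> x; rewrite -[RHS]wordK; apply/wdE; rewrite -[X in coxeq _ _ X]cat0s.
by apply: coxeq_cat; [exact: word_wd | exact: coxeq_refl].
Qed.

Lemma cox_mulr1 : right_id (wd [::]) cox_mul.
Proof.
move=> x; rewrite -[RHS]wordK; apply/wdE; rewrite -[X in coxeq _ _ X]cats0.
by apply: coxeq_cat; [exact: coxeq_refl | exact: word_wd].
Qed.

Lemma cox_mulV : left_inverse (wd [::]) cox_inv cox_mul.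
Proof.
move=> x; apply/wdE; apply: (@coxeq_trans _ _ _ (rev (word x) ++ word x)).
  by apply: coxeq_cat; [exact: word_wd | exact: coxeq_refl].
by rewrite -{2}(revK (word x)); exact: coxeq_revr.
Qed.

Lemma cox_mulrV : right_inverse (wd [::]) cox_inv cox_mul.
Proof.
move=> x; apply/wdE; apply: (@coxeq_trans _ _ _ (word x ++ rev (word x))).
  by apply: coxeq_cat; [exact: coxeq_refl | exact: word_wd].
exact: coxeq_revr.
Qed.

HB.instance Definition _ :=
  isGroup.Build G cox_mulA cox_mul1 cox_mulr1 cox_mulV cox_mulrV.

Local Open Scope group_scope.

Lemma wd_cat u v : wd (u ++ v) = wd u * wd v.
Proof.
by apply/wdE/coxeq_sym; apply: coxeq_cat; exact: word_wd.
Qed.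

Lemma wd0 : wd [::] = 1. Proof. by []. Qed.

Lemma wd_rev w : wd (rev w) = (wd w)^-1.
Proof. by apply/wdE/coxeq_rev/coxeq_sym => //; exact: word_wd. Qed.

Definition gen (s : S) : G := wd [:: s].

Lemma wd_cons s w : wd (s :: w) = gen s * wd w.
Proof. exact: (wd_cat [:: s]). Qed.

Lemma wd_rcons s w : wd (rcons w s) = wd w * gen s.
Proof. by rewrite -cats1 wd_cat. Qed.

Lemma gen2 s : gen s * gen s = 1.
Proof. by rewrite -wd_cons; apply/wdE/coxeq_ss. Qed.

Lemma genV s : (gen s)^-1 = gen s.
Proof. exact: mulg1_eq (gen2 s). Qed.

End CoxeterGroupStructure.

(** * Reflections and the parity cocycle [inv] *)

Section Reflections.
Variables (S : finType) (m : S -> S -> nat) (mP : coxeter_matrix m).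
Local Notation G := (coxgroup mP).
Local Notation wd := (wd mP).
Local Notation gen := (gen mP).
Implicit Types (x y z t : G) (u v w : seq S) (s : S) (U : {set S}).
Local Open Scope group_scope.

(* For [w = s_1 ... s_n], the list of the reflections
   [s_1 ... s_(j-1) s_j s_(j-1) ... s_1]. *)
Fixpoint rl w : seq G :=
  if w is s :: w' then gen s :: [seq t ^ gen s | t <- rl w'] else [::].

Lemma size_rl w : size (rl w) = size w.
Proof. by elim: w => //= s w IH; rewrite size_map IH. Qed.

Lemma rl_cat u v : rl (u ++ v) = rl u ++ [seq t ^ (wd u)^-1 | t <- rl v].
Proof.
elim: u => [|s u IH] /=; first by rewrite wd0 invg1 map_id_in // => t _; rewrite conjg1.
rewrite IH map_cat -map_comp; congr (_ :: _ ++ _); apply: eq_map => t /=.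
by rewrite -conjgM wd_cons invgM genV.
Qed.

Lemma wd_relator s s' k :
  wd (flatten (nseq k [:: s; s'])) = (gen s * gen s') ^+ k.
Proof.
by elim: k => //= k IH; rewrite !wd_cons IH expgS mulgA.
Qed.

Lemma rl_relator s s' k : rl (flatten (nseq k [:: s; s'])) =
  [seq (gen s * gen s') ^+ j * gen s | j <- iota 0 k.*2].
Proof.
elim: k => //= k IH; rewrite mul1g expg1 IH; congr [:: _, _ & _].
  by rewrite conjgE genV mulgA.
rewrite -!map_comp (iotaDl 2 0) -map_comp; apply: eq_map => j /=.
rewrite -conjgM conjgE invgM !genV; set p := gen s * gen s'.
by rewrite !mulgA -expgS -(mulgA _ (gen s) (gen s')) -/p -expgSr.
Qed.

Lemma wd_rel r : relator m r -> wd r = 1.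
Proof.
move=> rr; rewrite -wd0; apply/wdE.
by have := coxeq_ins [::] [::] rr; rewrite /= cats0 => /coxeq_sym.
Qed.

(** Only the parity of the multiplicity is invariant under the relations of the group: inserting a
    relator adds each reflection an even number of times. *)
Definition par w t := odd (count_mem t (rl w)).

Lemma count_conj t x (l : seq G) :
  count_mem t [seq y ^ x^-1 | y <- l] = count_mem (t ^ x) l.
Proof.
rewrite count_map; apply: eq_count => y /=.
by rewrite -(inj_eq (@conjg_inj _ x)) conjgKV.
Qed.

Lemma par_cat u v t : par (u ++ v) t = par u t (+) par v (t ^ wd u).
Proof. by rewrite /par rl_cat count_cat oddD count_conj. Qed.

(** The reflections of the relator are [(gen s * gen s') ^+ j * gen s] for [j] below twice [m s s'].
    Since [(gen s * gen s') ^+ m s s' = 1], the second half of the list repeats the first. *)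
Lemma par_relator r t : relator m r -> par r t = false.
Proof.
move=> rr; have := wd_rel rr; case: rr => s [s' [ms ->]].
rewrite wd_relator /par rl_relator => p1.
rewrite -addnn iotaD map_cat count_cat add0n.
rewrite -{2}[m s s']addn0 iotaDl -map_comp oddD.
rewrite [X in _ (+) odd X](_ : _ = count_mem t
  [seq (gen s * gen s') ^+ j * gen s | j <- iota 0 (m s s')]) ?addbb //.
by congr count; apply: eq_map => j /=; rewrite expgnDr p1 mul1g.
Qed.

Lemma par_coxeq u v t : coxeq m u v -> par u t = par v t.
Proof.
move=> h; elim: h t => {u v} [w|w w' _ h|w1 w2 w3 _ h _ h'|a b r rr] t //.
  by rewrite h.
by rewrite !par_cat (par_relator _ rr) (wd_rel rr) conjg1.
Qed.

Lemma size_coxeq u v : coxeq m u v -> odd (size u) = odd (size v).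
Proof.
elim=> {u v} [w|w w' _ ->|w1 w2 w3 _ -> _ ->|a b r [s [s' [_ ->]]]] //.
rewrite !size_cat !oddD; congr addb.
by rewrite (_ : odd (size (flatten _)) = false) //; elim: (m s s') => //= k ->.
Qed.

(* [inv x] is the characteristic function of the set of reflections [t]
   with [l(t x) < l(x)]; see [inv_len]. *)
Definition inv x t := par (word x) t.
Definition sgn x := odd (size (word x)).

Lemma inv_wd w t : inv (wd w) t = par w t.
Proof. exact/par_coxeq/word_wd. Qed.

Lemma sgn_wd w : sgn (wd w) = odd (size w).
Proof. exact: (size_coxeq (word_wd mP w)). Qed.

Lemma invM x y t : inv (x * y) t = inv x t (+) inv y (t ^ x).
Proof.
by rewrite -{1}(wordK x) -{1}(wordK y) -wd_cat inv_wd par_cat wordK.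
Qed.

Lemma sgnM x y : sgn (x * y) = sgn x (+) sgn y.
Proof.
by rewrite -{1}(wordK x) -{1}(wordK y) -wd_cat sgn_wd size_cat oddD.
Qed.

Lemma inv1 t : inv 1 t = false.
Proof. by rewrite -wd0 inv_wd. Qed.

Lemma inv_gen s t : inv (gen s) t = (t == gen s).
Proof. by rewrite inv_wd /par /= addn0 oddb eq_sym. Qed.

Lemma invV x t : inv x^-1 t = inv x (t ^ x^-1).
Proof.
have := inv1 (t ^ x^-1); rewrite -(mulgV x) invM conjgKV.
by case: (inv x _); case: (inv _ t).
Qed.

Lemma sgn1 : sgn 1 = false.
Proof. by rewrite -wd0 sgn_wd. Qed.

Lemma sgn_gen s : sgn (gen s) = true.
Proof. by rewrite sgn_wd. Qed.

Lemma sgnV x : sgn x^-1 = sgn x.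
Proof. by have := sgn1; rewrite -(mulVg x) sgnM; case: (sgn x); case: (sgn _). Qed.

Definition refl t := exists x s, t = gen s ^ x.

Lemma refl_gen s : refl (gen s).
Proof. by exists 1, s; rewrite conjg1. Qed.

Lemma reflJ t x : refl t -> refl (t ^ x).
Proof. by case=> y [s ->]; exists (y * x), s; rewrite conjgM. Qed.

Lemma refl2 t : refl t -> t * t = 1.
Proof. by case=> x [s ->]; rewrite -conjMg gen2 conj1g. Qed.

Lemma reflV t : refl t -> t^-1 = t.
Proof. by move/refl2/mulg1_eq. Qed.

Lemma refl_sgn t : refl t -> sgn t.
Proof.
by case=> x [s ->]; rewrite conjgE !sgnM sgnV sgn_gen; case: (sgn x).
Qed.

(** For [t = gen s ^ x] the cocycle identity gives one contribution from the middle letter and two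
    equal ones from [x^-1] and [x], which cancel. *)
Lemma refl_inv t : refl t -> inv t t.
Proof.
case=> x [s ->]; rewrite {1}conjgE !invM invV conjgK inv_gen eqxx.
by rewrite [gen s ^ gen s]conjgE genV gen2 mulg1; case: (inv _ _).
Qed.

End Reflections.

(** * Length, reduced words, inversions and descents *)

Section Length.
Variables (S : finType) (m : S -> S -> nat) (mP : coxeter_matrix m).
Local Notation G := (coxgroup mP).
Local Notation wd := (wd mP).
Local Notation gen := (gen mP).
Local Notation rl := (rl mP).
Implicit Types (x y z t : G) (u v w : seq S) (s : S) (U : {set S}).
Local Open Scope group_scope.

Lemma len_ex x : exists n, `[< exists w, size w = n /\ wd w = x >].
Proof. by exists (size (word x)); apply/asboolP; exists (word x); rewrite wordK. Qed.

Definition len x := ex_minn (len_ex x).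

Lemma rword_ex x : exists w, size w = len x /\ wd w = x.
Proof. by rewrite /len; case: ex_minnP => n /asboolP[w [<- <-]] _; exists w. Qed.

Definition rword x := sval (cid (rword_ex x)).

Lemma rwordK x : wd (rword x) = x.
Proof. by rewrite /rword; case: cid => w []. Qed.

Lemma size_rword x : size (rword x) = len x.
Proof. by rewrite /rword; case: cid => w []. Qed.

Lemma len_wd w : len (wd w) <= size w.
Proof.
by rewrite /len; case: ex_minnP => n _; apply; apply/asboolP; exists w.
Qed.

Definition red w := size w == len (wd w).

Lemma red_rword x : red (rword x).
Proof. by rewrite /red rwordK size_rword. Qed.

Lemma len1 : len 1 = 0%N.
Proof. by apply/eqP; rewrite -leqn0 -wd0; exact: (len_wd [::]). Qed.

Lemma len_eq0 x : len x = 0%N -> x = 1.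
Proof.
by rewrite -size_rword -{2}(rwordK x) => /eqP; rewrite size_eq0 => /eqP ->.
Qed.

Lemma lenM x y : len (x * y) <= len x + len y.
Proof.
rewrite -[in leqLHS](rwordK x) -[in leqLHS](rwordK y) -wd_cat.
by apply: leq_trans (len_wd _) _; rewrite size_cat !size_rword.
Qed.

Lemma lenV_le x : len x^-1 <= len x.
Proof.
rewrite -[in leqLHS](rwordK x) -wd_rev.
by apply: leq_trans (len_wd _) _; rewrite size_rev size_rword.
Qed.

Lemma lenV x : len x^-1 = len x.
Proof.
by apply/eqP; rewrite eqn_leq lenV_le; have := lenV_le x^-1; rewrite invgK.
Qed.

Lemma odd_len x : odd (len x) = sgn x.
Proof. by rewrite -size_rword -(sgn_wd mP) rwordK. Qed.

Lemma len_gen s : len (gen s) = 1%N.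
Proof.
have := len_wd [:: s]; rewrite -/(gen s) /= leq_eqVlt ltnS leqn0.
case/orP=> /eqP // /len_eq0 h.
by have := sgn_gen mP s; rewrite h sgn1.
Qed.

Lemma rl_split w t : t \in rl w ->
  exists u s v, w = u ++ s :: v /\ t = gen s ^ (wd u)^-1.
Proof.
elim: w t => //= s w IH t; rewrite inE => /orP[/eqP ->|/mapP[t' /IH]].
  by exists [::], s, w; rewrite wd0 invg1 conjg1.
move=> [u [s' [v [-> ->]]]] ->; exists (s :: u), s', v.
by rewrite wd_cons invgM genV conjgM.
Qed.

Lemma wd_delete u s v : wd (u ++ v) = gen s ^ (wd u)^-1 * wd (u ++ s :: v).
Proof.
by rewrite !wd_cat wd_cons conjgE invgK -!mulgA mulKg (mulgA (gen s)) gen2 mul1g.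
Qed.

(** The exchange condition: deleting the letter that contributes [t] amounts to multiplying by [t]
    on the left. *)
Lemma rl_delete w t : t \in rl w -> exists w',
  [/\ subseq w' w, (size w').+1 = size w & wd w' = t * wd w].
Proof.
case/rl_split=> u [s [v [-> ->]]]; exists (u ++ v).
by rewrite -wd_delete !size_cat /= addnS cat_subseq // subseq_cons.
Qed.

Lemma par_mem w t : par w t -> t \in rl w.
Proof. by rewrite /par; case: (boolP (t \in rl w)) => // /count_memPn ->. Qed.

Lemma rl_refl w t : t \in rl w -> refl t.
Proof. by case/rl_split=> u [s [v [_ ->]]]; exists (wd u)^-1, s. Qed.

Lemma inv_refl x t : inv x t -> refl t.
Proof. by move/par_mem/rl_refl. Qed.

Lemma inv_lt x t : inv x t -> len (t * x) < len x.
Proof.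
rewrite -{1}(rwordK x) inv_wd => /par_mem/rl_delete[w [_ sw]].
rewrite rwordK => <-; apply: leq_ltn_trans (len_wd _) _.
by rewrite -(size_rword x) -sw.
Qed.

(** If [t] is not an inversion of [x], the cocycle identity and [refl_inv] make it one of [t * x],
    to which [inv_lt] then applies. *)
Lemma inv_len x t : refl t -> inv x t = (len (t * x) < len x).
Proof.
move=> rt; apply/idP/idP; first exact: inv_lt.
apply: contraTT => Nx; rewrite -leqNgt ltnW //.
have -> : x = t * (t * x) by rewrite mulgA refl2 // mul1g.
rewrite [in ltnRHS]mulgA refl2 // mul1g.
apply: inv_lt; rewrite invM refl_inv //= [t ^ t]conjgE reflV // refl2 // mulg1.
by rewrite (negbTE Nx).
Qed.

Lemma len_conj s x : len (gen s ^ x) <= (len x).*2.+1.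
Proof.
rewrite conjgE; apply: leq_trans (lenM _ _) _; rewrite lenV.
by rewrite -addnn -addnS leq_add2l; have := lenM (gen s) x; rewrite len_gen.
Qed.

Lemma red_cons s w : red (s :: w) -> red w.
Proof.
rewrite /red /= wd_cons => /eqP h; rewrite eqn_leq len_wd andbT.
by have := lenM (gen s) (wd w); rewrite -h len_gen; lia.
Qed.

(** If [gen s] recurred among the later reflections, deleting the corresponding letter of [w] would
    express [wd (s :: w)] by a word with two letters fewer. *)
Lemma uniq_rl w : red w -> uniq (rl w).
Proof.
elim: w => //= s w IH rw; rewrite map_inj_uniq; last exact: conjg_inj.
rewrite IH ?(red_cons rw) // andbT; apply/negP => /mapP[t tw].
move/eqP; rewrite eq_sym -(inj_eq (@conjg_inj _ (gen s)^-1)) conjgK.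
rewrite [gen s ^ _]conjgE !genV gen2 mulg1 => /eqP et; move: tw; rewrite et.
case/rl_delete=> w' [_ sw']; rewrite -wd_cons => ew.
by move: rw; rewrite /red /= -ew => /eqP; have := len_wd w'; lia.
Qed.

Lemma inv_red w t : red w -> inv (wd w) t = (t \in rl w).
Proof. by move=> /uniq_rl uw; rewrite inv_wd /par count_uniq_mem // oddb. Qed.

Lemma inv_rword x t : inv x t = (t \in rl (rword x)).
Proof. by rewrite -inv_red ?red_rword // rwordK. Qed.

Lemma inv_conj_len x t : inv x t -> len t < (len x).*2.
Proof.
rewrite inv_rword => /rl_split[u [s [v [e ->]]]].
apply: leq_ltn_trans (len_conj _ _) _; rewrite lenV.
have := len_wd u; have := size_rword x; rewrite e size_cat /=; lia.
Qed.

(** Under this inclusion, the sum modulo 2 in the cocycle identity for [x = y * (y^-1 * x)] is a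
    disjoint union. Thus [y] is a prefix of [x], and weights will factor accordingly. *)
Lemma inv_sub_perm x y : (forall t, inv y t -> inv x t) ->
  perm_eq (rl (rword x))
          (rl (rword y) ++ [seq t ^ y^-1 | t <- rl (rword (y^-1 * x))]).
Proof.
move=> yx; have invE t : inv x t = inv y t (+) inv (y^-1 * x) (t ^ y).
  by rewrite -invM mulVKg.
have memE t : (t \in [seq t ^ y^-1 | t <- rl (rword (y^-1 * x))]) =
    inv (y^-1 * x) (t ^ y).
  by rewrite inv_rword -{1}[t](conjgK y); exact: (mem_map (@conjg_inj _ y^-1)).
apply: uniq_perm; first exact/uniq_rl/red_rword.
  rewrite cat_uniq uniq_rl ?red_rword // map_inj_uniq; last exact: conjg_inj.
  rewrite uniq_rl ?red_rword // andbT; apply/hasPn => t; rewrite memE -inv_rword.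
  by apply: contraL => yt; have := invE t; rewrite yx // yt; case: (inv _ _).
move=> t; rewrite mem_cat memE -!inv_rword invE.
by have := yx t; rewrite invE; case: (inv y t) => //= /(_ isT) ->.
Qed.

Lemma red_cat x y : len (x * y) = len x + len y -> red (rword x ++ rword y).
Proof. by rewrite /red wd_cat !rwordK size_cat !size_rword => ->. Qed.

Lemma inv_mul_sub x y t : len (x * y) = len x + len y ->
  inv x t -> inv (x * y) t.
Proof.
move=> /red_cat rxy; rewrite -{2}(rwordK x) -(rwordK y) -wd_cat inv_red //.
by rewrite rl_cat mem_cat inv_rword => ->.
Qed.

Lemma inv_mul_or x y t : inv (x * y) t -> inv x t \/ inv y (t ^ x).
Proof. by rewrite invM; case: (inv x t) => //=; [left|right]. Qed.

Definition desc x s := len (x * gen s) < len x.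

Lemma conj_genM x s : gen s ^ x^-1 * x = x * gen s.
Proof. by rewrite conjgE invgK -!mulgA mulVg mulg1. Qed.

Lemma descE x s : desc x s = inv x (gen s ^ x^-1).
Proof. by rewrite inv_len ?conj_genM //; exact/reflJ/refl_gen. Qed.

Lemma genK x s : x * gen s * gen s = x.
Proof. by rewrite -mulgA gen2 mulg1. Qed.

Lemma len_desc x s : desc x s -> (len (x * gen s)).+1 = len x.
Proof.
rewrite /desc => h; have := lenM (x * gen s) (gen s); rewrite genK len_gen; lia.
Qed.

Lemma len_asc x s : ~~ desc x s -> len (x * gen s) = (len x).+1.
Proof.
rewrite /desc -leqNgt => h; have := lenM x (gen s); rewrite len_gen.
(* Parity excludes equality, as generators have odd sign. *)
suff : len (x * gen s) <> len x by lia.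
move=> e; have := odd_len (x * gen s); rewrite e odd_len sgnM sgn_gen.
by case: (sgn x).
Qed.

Lemma desc_mulgen x s : desc (x * gen s) s = ~~ desc x s.
Proof.
rewrite {1}/desc genK; case: (boolP (desc x s)) => h.
  by rewrite -(len_desc h) ltnNge leqnSn.
by rewrite (len_asc h) ltnSn.
Qed.

Lemma inv_mulgen x s t : inv (x * gen s) t = inv x t (+) (t == gen s ^ x^-1).
Proof.
by rewrite invM inv_gen -(inj_eq (@conjg_inj _ x^-1)) conjgK.
Qed.

(** A list, possibly with repetitions, that exhausts the elements of length at most [n]; its size
    serves as a numerical bound. *)
Fixpoint ball n : seq G :=
  if n is n'.+1 then ball n' ++ [seq x * gen s | x <- ball n', s <- enum S]
  else [:: 1].

Lemma ballP n x : len x <= n -> x \in ball n.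
Proof.
elim: n x => [|n IH] x /=.
  by rewrite leqn0 => /eqP/len_eq0 ->; rewrite inE.
rewrite mem_cat leq_eqVlt ltnS => /orP[/eqP lx|/IH -> //].
apply/orP; right; have [w [+ <-]] := rword_ex x; rewrite lx.
case/lastP: w => // w s; rewrite size_rcons wd_rcons => -[sw].
apply: allpairs_f; last by rewrite mem_enum.
by apply: IH; rewrite -sw; exact: len_wd.
Qed.

End Length.

(** * Dihedral reflection subgroups and the prefix property of maximal inversions *)

Section Dihedral.
Variables (S : finType) (m : S -> S -> nat) (mP : coxeter_matrix m).
Local Notation G := (coxgroup mP).
Local Notation gen := (gen mP).
Implicit Types (x y z t a b u r : G) (s : S).
Local Open Scope group_scope.

Fixpoint alt a b k : G := if k is k'.+1 then a * alt b a k' else 1.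

Lemma alt_add a b k n :
  alt a b (k + n) = alt a b k * (if odd k then alt b a n else alt a b n).
Proof.
elim: k a b => [|k IH] a b /=; first by rewrite mul1g.
by rewrite IH mulgA; case: (odd k).
Qed.

Lemma alt_even a b j : alt a b j.*2 = (a * b) ^+ j.
Proof. by elim: j => //= j ->; rewrite mulgA expgS. Qed.

Lemma alt_odd a b j : alt a b j.*2.+1 = (a * b) ^+ j * a.
Proof. by rewrite -addn1 alt_add odd_double /= mulg1 alt_even. Qed.

Lemma altV a b k : a * a = 1 -> b * b = 1 ->
  (alt a b k)^-1 = if odd k then alt a b k else alt b a k.
Proof.
move=> a2 b2; elim: k a b a2 b2 => [|k IH] a b a2 b2; first by rewrite invg1.
rewrite [in LHS]/= invgM IH // (mulg1_eq a2) -addn1 oddD addbT !alt_add /=.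
by case: (odd k); rewrite /= mulg1.
Qed.

(** For involutions [a] and [b] this is the dihedral subgroup generated by them. *)
Definition dih a b x := exists k, x = alt a b k \/ x = alt b a k.

Lemma dihC a b x : dih a b x -> dih b a x.
Proof. by case=> k [] ->; exists k; [right|left]. Qed.

Lemma dih_mull a b x : a * a = 1 -> dih a b x -> dih a b (a * x).
Proof.
move=> a2 [k [->|->]]; last by exists k.+1; left.
case: k => [|k]; first by exists 1%N; left.
by exists k; right; rewrite /= mulgA a2 mul1g.
Qed.

Lemma dihl a b : dih a b a.
Proof. by exists 1%N; left; rewrite /= mulg1. Qed.

Lemma dihr a b : dih a b b.
Proof. exact/dihC/dihl. Qed.

Lemma dihM a b x y : a * a = 1 -> b * b = 1 ->
  dih a b x -> dih a b y -> dih a b (x * y).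
Proof.
move=> a2 b2 [k]; elim: k a b a2 b2 x => [|k IH] a b a2 b2 x.
  by case=> ->; rewrite mul1g.
case=> -> Dy /=; rewrite -mulgA.
  by apply: dih_mull => //; apply: (IH a b) => //; right.
by apply/dihC/dih_mull => //; apply/dihC/(IH a b) => //; left.
Qed.

Lemma dihV a b x : a * a = 1 -> b * b = 1 -> dih a b x -> dih a b x^-1.
Proof.
move=> a2 b2 [k [->|->]]; rewrite altV //; exists k; case: (odd k);
  by [left|right].
Qed.

Lemma dihJ a b x y : a * a = 1 -> b * b = 1 ->
  dih a b x -> dih a b y -> dih a b (x ^ y).
Proof.
move=> a2 b2 Dx Dy; rewrite conjgE; apply: dihM => //; first exact: dihV.
exact: dihM.
Qed.

Lemma dih_sub a b u r x : a * a = 1 -> b * b = 1 ->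
  dih a b u -> dih a b r -> dih u r x -> dih a b x.
Proof.
move=> a2 b2 Du Dr [k]; elim: k u r Du Dr x => [|k IH] u r Du Dr x.
  by case=> ->; exists 0%N; left.
by case=> -> /=; apply: dihM => //; [apply: (IH u r)|apply: (IH u r)] => //;
  [right|left].
Qed.

(** An element of odd sign is an alternating word with an odd number of letters, and such a
    palindrome is conjugate to its middle letter. *)
Lemma dih_refl a b x : refl a -> refl b -> dih a b x -> sgn x -> refl x.
Proof.
move=> ra rb [k]; wlog -> : a b ra rb x / x = alt a b k.
  by move=> W [e|e]; [apply: (W a b) => //; left|apply: (W b a) => //; left].
move=> _; have -> : sgn (alt a b k) = odd k.
  elim: k a b ra rb {x} => [|k IH] a b ra rb /=; first by rewrite sgn1.
  by rewrite sgnM IH // refl_sgn.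
move=> ok; have -> : k = k./2.*2.+1 by rewrite -{1}(odd_double_half k) ok.
elim: k./2 a b ra rb {x} => [|j IH] a b ra rb; first by rewrite /= mulg1.
have -> : alt a b j.+1.*2.+1 = alt b a j.*2.+1 ^ a.
  transitivity (a * alt b a (j.*2.+1 + 1)); first by rewrite addn1 doubleS.
  by rewrite alt_add [odd _]/= odd_double [alt a b 1]/= mulg1 conjgE reflV.
exact/reflJ/IH.
Qed.

(** Cut a reduced word of [t] at the letter [s] that contributes the inversion [t] itself. Deleting
    this letter gives [t * t = 1], so the two remaining pieces are inverse to each other. *)
Lemma refl_half t : refl t ->
  exists g s, t = gen s ^ g^-1 /\ len t = (len g).*2.+1.
Proof.
move=> rt; have := refl_inv rt; rewrite inv_rword => /rl_split.
case=> u [s [v [e et]]]; exists (wd mP u), s; split=> //.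
have := wd_delete mP u s v; rewrite -e rwordK -et refl2 // wd_cat.
move/(canRL (mulKg _)); rewrite mulg1 => ev.
apply/eqP; rewrite eqn_leq {1}et -[in X in _ && X](size_rword t) e size_cat /=.
rewrite -[X in _ <= X.*2.+1]lenV len_conj /= addnS ltnS -addnn.
apply: leq_add; first exact: len_wd.
by rewrite -lenV -ev; exact: len_wd.
Qed.

(** Write [t] as the conjugate of [gen s] by its half [g]. One of [t'] and [t' ^ t] is an inversion
    of [g]; it is therefore short, and it shortens [g], hence also the conjugate of [t]. *)
Lemma refl_lower t t' : refl t -> inv t t' -> t' <> t -> exists t'',
  [/\ t'' = t' \/ t'' = t' ^ t, inv t t'', len t'' < len t
    & len (t ^ t'') < len t].
Proof.
move=> rt tt' nt'; have [g [s [et lt]]] := refl_half rt.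
have lower t'' : inv g t'' -> len t'' < len t /\ len (t ^ t'') < len t.
  move=> gt; split; first by have := inv_conj_len gt; rewrite lt; lia.
  rewrite {1}et -conjgM -[t''](reflV (inv_refl gt)) -invgM.
  have := len_conj s (t'' * g)^-1; rewrite lenV => /leq_ltn_trans -> //.
  by rewrite lt ltnS ltn_double inv_lt.
have tE : t = g * (gen s * g^-1) by rewrite et conjgE invgK.
have : inv g t' \/ inv g (t' ^ t).
  move: (tt'); rewrite tE !invM inv_gen invV -!conjgM -tE.
  case: eqP => [e|_]; last by case: (inv g t') => /=; [left|right].
  by case: nt'; rewrite et -e conjgK.
case=> /lower[l1 l2]; [exists t'|exists (t' ^ t)]; split=> //.
- by left.
- by right.
by have := inv1 t'; rewrite -(refl2 rt) invM tt'; case: (inv t (t' ^ t)).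
Qed.

(** The canonical generators of the reflection subgroup [dih u r]. *)
Definition dsimple u r t := [/\ dih u r t, refl t
  & forall t', dih u r t' -> inv t t' -> t' = t].

Section DihedralGenerators.
Variables u r : G.
Hypotheses (ru : refl u) (rr : refl r).
Local Notation D := (dih u r).
Local Notation u2 := (refl2 ru).
Local Notation r2 := (refl2 rr).

(** Induction on length: if [t] is not canonical, [refl_lower] gives [t = t'' * (t ^ t'') * t'']
    with strictly shorter reflections of the subgroup. *)
Lemma dsimple_gen (Q : G -> Prop) : (forall t, dsimple u r t -> Q t) ->
  (forall x y, Q x -> Q y -> Q (x * y)) -> forall t, D t -> refl t -> Q t.
Proof.
move=> Qs QM t; have [n] := ubnP (len t).
elim: n t => // n IH t lt Dt rt.
have [st|nst] := pselect (forall t', D t' -> inv t t' -> t' = t).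
  exact: Qs.
have {nst} [t' [Dt' [tt' ne]]] : exists t', D t' /\ inv t t' /\ t' <> t.
  apply: contrapT => h; apply: nst => t' Dt' tt'.
  by apply: contrapT => ne; apply: h; exists t'.
have [t'' [t''E tt'' l1 l2]] := refl_lower rt tt' ne.
have Dt'' : D t'' by case: t''E => -> //; apply: dihJ; rewrite ?u2 ?r2.
have rt'' := inv_refl tt''.
have Q1 : Q t'' by apply: IH => //; lia.
have Q2 : Q (t ^ t'').
  by apply: IH; [lia | apply: dihJ; rewrite ?u2 ?r2 | exact: reflJ].
have -> : t = t'' * ((t ^ t'') * t'').
  by rewrite conjgE reflV // -!mulgA refl2 // mulg1 mulgA refl2 // mul1g.
by apply: (QM) => //; exact: QM.
Qed.

(* [b a c] is a reflection, so it would lie in its own inversion set, which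
   the cocycle identity excludes. *)
Lemma dsimple_le2 a b c : dsimple u r a -> dsimple u r b -> dsimple u r c ->
  a <> b -> b <> c -> a <> c -> False.
Proof.
move=> [Da ra Ia] [Db rb Ib] [Dc rc Ic] ab bc ac.
pose z := b * (a * c).
have DM := fun x y => @dihM u r x y u2 r2.
have Dz : D z := DM _ _ Db (DM _ _ Da Dc).
have rz : refl z.
  by apply: (dih_refl ru rr Dz); rewrite !sgnM !refl_sgn.
have : inv z z by exact: refl_inv.
have eq1 (x y : G) : refl x -> refl y -> x * y = 1 -> x = y.
  by move=> rx ry /mulg1_eq <-; rewrite reflV.
rewrite {1}/z !invM; have -> : inv b z = false.
  apply/negP => /(Ib _ Dz); rewrite /z -{2}(mulg1 b) => /mulgI/eq1 e.
  by apply: ac; exact: e.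
have zb : z ^ b = a * (c * b).
  by rewrite conjgE reflV // /z !mulgA refl2 // mul1g.
have -> : inv a (z ^ b) = false.
  apply/negP => /Ia; rewrite zb -[X in _ = X](mulg1 a) => h.
  have /mulgI/eq1 e := h (DM _ _ Da (DM _ _ Dc Db)).
  by apply: bc; rewrite e.
have zba : (z ^ b) ^ a = c * (b * a).
  by rewrite zb conjgE reflV // !mulgA refl2 // mul1g.
apply/negP => /=; apply/negP => /Ic; rewrite zba -[X in _ = X](mulg1 c) => h.
have /mulgI/eq1 e := h (DM _ _ Dc (DM _ _ Db Da)).
by apply: ab; rewrite e.
Qed.

(** A canonical generator exists, by [dsimple_gen] for the false predicate. If it were the only one,
    it would be the only reflection of the subgroup, so [u = r]. By [dsimple_le2] there is no third
    one, so the two generate. *)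
Lemma dsimple_pair : u <> r -> exists a b,
  [/\ dsimple u r a, dsimple u r b, a <> b & forall x, D x <-> dih a b x].
Proof.
move=> ne.
have [a sa] : exists a, dsimple u r a.
  apply: contrapT => h; apply: (@dsimple_gen (fun _ => False) _ _ u) => //.
    by move=> t st; apply: h; exists t.
  exact: dihl.
have [[b [sb ab]]|h] := pselect (exists b, dsimple u r b /\ a <> b); last first.
  have {}h t : D t -> refl t -> t = a.
    move=> Dt rt; suff [t1|//] : t = 1 \/ t = a.
      by have := refl_sgn rt; rewrite t1 sgn1.
    apply: (@dsimple_gen (fun t => t = 1 \/ t = a)) rt => // [t' st'|x y].
      by right; apply: contrapT => n; apply: h; exists t'; split=> // e; apply: n.
    have a2 : a * a = 1 by case: sa => _ /refl2.
    by move=> [->|->] [->|->]; rewrite ?mul1g ?mulg1 ?a2; [left|right|right|left].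
  by case: ne; rewrite (h _ (dihl u r) ru) (h _ (dihr u r) rr).
exists a, b; split=> // x.
have [[Da ra _] [Db rb _]] := (sa, sb).
have a2 := refl2 ra; have b2 := refl2 rb.
have sub t : D t -> refl t -> dih a b t.
  apply: dsimple_gen => [t' st'|x' y']; last exact: dihM.
  have [->|n1] := pselect (t' = a); first exact: dihl.
  have [->|n2] := pselect (t' = b); first exact: dihr.
  by case: (dsimple_le2 sa sb st' ab) => e; [apply: n2|apply: n1].
split; last exact: (dih_sub u2 r2 Da Db).
exact: (dih_sub a2 b2 (sub _ (dihl _ _) ru) (sub _ (dihr _ _) rr)).
Qed.

End DihedralGenerators.

Section DihedralInversions.
Variables a b : G.
Hypotheses (ra : refl a) (rb : refl b).

(** The analogue of [rl] for the word [alt a b k] in the letters [a] and [b]. *)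
Definition gam k : seq G := [seq (a * b) ^+ j * a | j <- iota 0 k].

Lemma gam_take n k : n <= k -> exists l, gam k = gam n ++ l.
Proof.
move=> nk; exists [seq (a * b) ^+ j * a | j <- iota n (k - n)].
by rewrite -map_cat -iotaD subnKC.
Qed.

Lemma gam_sub n k t : n <= k -> t \in gam n -> t \in gam k.
Proof. by case/gam_take=> l ->; rewrite mem_cat => ->. Qed.

Lemma gam_uniq n k : n <= k -> uniq (gam k) -> uniq (gam n).
Proof. by case/gam_take=> l ->; rewrite cat_uniq => /andP[]. Qed.

Lemma gamS k : gam k.+1 = rcons (gam k) ((a * b) ^+ k * a).
Proof. by rewrite /gam -addn1 iotaD map_cat cats1. Qed.

Lemma mem_gam k j : j < k -> (a * b) ^+ j * a \in gam k.
Proof. by move=> jk; apply: map_f; rewrite mem_iota. Qed.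

(** The first factor is the involution [alt a b j.*2.+1]. It begins with [alt a b k], so, being its
    own inverse, it ends with the inverse of [alt a b k], which cancels. *)
Lemma gam_mul k j : k <= j.*2.+1 ->
  (a * b) ^+ j * a * alt a b k = alt a b (j.*2.+1 - k).
Proof.
move=> kj; have a2 := refl2 ra; have b2 := refl2 rb.
have e : (alt a b j.*2.+1)^-1 = alt a b j.*2.+1.
  by rewrite altV // [odd _]/= odd_double.
rewrite -alt_odd -e -{1}(subnKC kj) alt_add invgM mulgVK.
set n := (_ - k)%N; have on : odd n = ~~ odd k.
  by rewrite /n oddB // [odd _.+1]/= odd_double.
by case: (boolP (odd k)) on => ok on; rewrite altV // on.
Qed.

End DihedralInversions.

(** Since [a] and [b] have no other inversion in the subgroup, the cocycle identity evaluates there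
    as for a word in the generators of a Coxeter group. *)
Lemma inv_alt a b k t : refl a -> refl b ->
  (forall t, dih a b t -> inv a t -> t = a) ->
  (forall t, dih a b t -> inv b t -> t = b) ->
  dih a b t -> inv (alt a b k) t = odd (count_mem t (gam a b k)).
Proof.
move=> ra rb Ia Ib; have a2 := refl2 ra; have b2 := refl2 rb.
elim: k a b ra rb Ia Ib a2 b2 t => [|k IH] a b ra rb Ia Ib a2 b2 t Dt /=.
  by rewrite inv1.
rewrite invM mul1g oddD oddb (IH b a) //.
- congr (_ (+) odd _).
    rewrite eq_sym; apply/idP/eqP => [/Ia -> //|->]; exact: refl_inv.
  rewrite (iotaDl 1) -map_comp !count_map; apply: eq_count => j /=.
  have -> : (b * a) ^+ j * b = ((a * b) ^+ j.+1 * a) ^ a.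
    rewrite conjgE reflV // -mulgA a2 mulg1 expgS !mulgA a2 mul1g.
    elim: j => [|j IHj]; first by rewrite !expg0 mul1g mulg1.
    by rewrite [in LHS]expgS -mulgA IHj [in RHS]expgS !mulgA.
  by rewrite (inj_eq (@conjg_inj _ a)).
- by move=> t' /dihC; exact: Ib.
- by move=> t' /dihC; exact: Ia.
- by apply/dihC/dihJ => //; exact: dihl.
Qed.

Section DihedralPrefix.
Variables a b : G.
Hypotheses (ra : refl a) (rb : refl b).
Hypotheses (Ia : forall t, dih a b t -> inv a t -> t = a)
           (Ib : forall t, dih a b t -> inv b t -> t = b).
Local Notation D := (dih a b).
Let a2 := refl2 ra.
Let b2 := refl2 rb.

Lemma gam_dih k t : t \in gam a b k -> D t.
Proof. by case/mapP=> j _ ->; exists j.*2.+1; left; rewrite alt_odd. Qed.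

(** Without repetitions, the last reflection of [alt a b n.+1] is an inversion, and multiplying by
    it removes the last letter. *)
Lemma len_alt_lt n k : uniq (gam a b k) -> n < k ->
  len (alt a b n) < len (alt a b n.+1).
Proof.
move=> uk nk; have tn := mem_gam a b (ltnSn n).
have h : inv (alt a b n.+1) ((a * b) ^+ n * a).
  by rewrite inv_alt // ?count_uniq_mem ?tn ?(gam_uniq nk) //; exact: gam_dih tn.
have := inv_lt h; rewrite (gam_mul ra rb); last by rewrite -addnn; lia.
by rewrite subSS -addnn addnK.
Qed.

(** Write [r = alt a b j.*2.+1] with [j < k]. If [k <= j.*2.+1], then [r * alt a b k] is an initial
    piece of the word [alt a b k], and inversions in the subgroup are nested. Otherwise the
    maximality of [r] leaves only the longest element of a finite dihedral group. *)
Lemma dih_prefix_alt k r u :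
  (forall n, alt a b k = alt a b n \/ alt a b k = alt b a n -> k <= n) ->
  D r -> inv (alt a b k) r ->
  (forall t, D t -> inv (alt a b k) t -> len t <= len r) ->
  D u -> inv (r * alt a b k) u -> inv (alt a b k) u.
Proof.
move=> kmin Dr vr rmax Du rvu; set c := a * b.
(* A coincidence would give [c ^+ d = 1] with [0 < d < k], and [alt a b k] would have an expression
   with fewer than [k] letters: either drop [d.*2] letters, or use the complementary word with
   [d.*2 - k] letters. *)
have cI (i j : nat) : i < j < k -> c ^+ i * a = c ^+ j * a -> False.
  move=> /andP[ij jk] /mulIg e.
  pose d := (j - i)%N; have c1 : c ^+ d = 1.
    by apply: (mulgI (c ^+ i)); rewrite -expgnDr mulg1 /d subnKC // ltnW.
  have [dk|dk] := leqP d.*2 k.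
    have := kmin (k - d.*2)%N; rewrite -{1}(subnKC dk) alt_add odd_double.
    by rewrite alt_even c1 mul1g => /(_ (or_introl erefl)); rewrite /d; lia.
  have := alt_even a b d; rewrite -/c c1 -{1}(subnKC (ltnW dk)) alt_add.
  move=> /(canRL (mulgK _)); rewrite mul1g => ev.
  have := kmin (d.*2 - k)%N; rewrite [in X in X -> _]ev.
  case: (odd k); rewrite altV //; case: (odd (_ - k)) => /=.
  - by move/(_ (or_intror erefl)); rewrite /d; lia.
  - by move/(_ (or_introl erefl)); rewrite /d; lia.
  - by move/(_ (or_introl erefl)); rewrite /d; lia.
  - by move/(_ (or_intror erefl)); rewrite /d; lia.
have uk : uniq (gam a b k).
  rewrite map_inj_in_uniq ?iota_uniq // => i j.
  rewrite !mem_iota /= !add0n => ik jk e.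
  have [ij|ji|//] := ltngtP i j.
    by have := cI i j; rewrite ij jk => /(_ isT e).
  by have := cI j i; rewrite ji ik => /(_ isT (esym e)).
have invk t : D t -> inv (alt a b k) t = (t \in gam a b k).
  by move=> Dt; rewrite inv_alt // count_uniq_mem // oddb.
move: (vr); rewrite invk // => /mapP[j]; rewrite mem_iota add0n /= => jk er.
have [kj|jk2] := leqP k j.*2.+1.
  move: rvu; rewrite er (gam_mul ra rb) // inv_alt // => /=.
  rewrite invk //; set n := (_ - k)%N => h; apply: (@gam_sub _ _ n).
    by rewrite /n; lia.
  by move: h; case: (boolP (u \in gam a b n)) => // /count_memPn ->.
(* Now [alt a b j.*2.+3] is also an inversion. It would be longer than [r] if lengths kept
   increasing for two more letters, which they do as long as [gam] has no repetition. *)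
have jk3 : j.+1 < k by lia.
have := rmax _ (gam_dih (mem_gam a b jk3)); rewrite invk ?mem_gam //; last first.
  exact: gam_dih (mem_gam a b jk3).
move/(_ isT); rewrite er -!alt_odd doubleS => lmax.
have l1 := len_alt_lt uk jk2.
have [k3|k2] := ltnP j.*2.+2 k.
  by have l2 := len_alt_lt uk k3; move: (leq_trans (ltn_trans l1 l2) lmax); rewrite ltnn.
have {k2 jk2} ek : k = j.*2.+2 by lia.
(* With [k = j.*2.+2], the increase at the next letter can fail only if the next reflection already
   occurs in [gam a b k]. *)
have [tk|tk] := boolP (c ^+ k * a \in gam a b k); last first.
  have uk1 : uniq (gam a b k.+1) by rewrite gamS rcons_uniq tk.
  have l2 : len (alt a b j.*2.+2) < len (alt a b j.*2.+3).
    by apply: (len_alt_lt uk1); rewrite ek.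
  by move: (leq_trans (ltn_trans l1 l2) lmax); rewrite ltnn.
move: tk => /mapP[[|i]]; rewrite mem_iota add0n /= => ik; last first.
  rewrite {1}ek => e; case: (cI i k.-1); first lia.
  apply: (mulgI c); rewrite !mulgA -!expgS prednK; last lia.
  by rewrite -e -ek.
(* The repetition forces [c ^+ k = 1]. Then [r * alt a b k = b], and [b] is the last entry of
   [gam a b k]. *)
rewrite mul1g -[X in _ = X](mul1g a) => /mulIg ck.
have rvb : r * alt a b k = b.
  have eb : alt a b j.*2.+2 = alt a b j.*2.+1 * b.
    by rewrite -[in LHS]addn1 alt_add [odd _]/= odd_double [alt b a 1]/= mulg1.
  have e : (alt a b j.*2.+1)^-1 = alt a b j.*2.+1.
    by rewrite altV // [odd _]/= odd_double.
  by rewrite er -alt_odd ek eb -{1}e mulKg.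
move: rvu; rewrite rvb => /(Ib Du) ->.
have eb : b = c ^+ k.-1 * a.
  apply: (mulgI c); rewrite mulgA -expgS prednK; last lia.
  by rewrite ck mul1g /c -mulgA b2 mulg1.
by rewrite invk; [rewrite {1}eb; apply: mem_gam; lia | exact: dihr].
Qed.

End DihedralPrefix.

Lemma dih_prefix a b v r u : refl a -> refl b ->
  (forall t, dih a b t -> inv a t -> t = a) ->
  (forall t, dih a b t -> inv b t -> t = b) ->
  dih a b v -> dih a b r -> inv v r ->
  (forall t, dih a b t -> inv v t -> len t <= len r) ->
  dih a b u -> inv (r * v) u -> inv v u.
Proof.
move=> ra rb Ia Ib Dv Dr vr rmax Du rvu.
have ex : exists n, `[< v = alt a b n \/ v = alt b a n >].
  by case: Dv => n h; exists n; apply/asboolP.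
case: (ex_minnP ex) => k /asboolP vk kmin.
have {}kmin n : v = alt a b n \/ v = alt b a n -> k <= n.
  by move=> h; apply: kmin; apply/asboolP.
case: vk => ev; rewrite ev in vr rmax rvu kmin *.
  exact: (dih_prefix_alt ra rb Ia Ib kmin Dr vr rmax Du rvu).
apply: (@dih_prefix_alt b a _ _ _ _ k r u) => //.
- by move=> t /dihC; exact: Ib.
- by move=> t /dihC; exact: Ia.
- by move=> n [e|e]; apply: kmin; [right|left].
- exact: dihC.
- by move=> t /dihC; exact: rmax.
- exact: dihC.
Qed.

(* Multiplying by an inversion of maximal length gives a prefix: compare the
   inversions of [r w] and [w] inside each dihedral subgroup [<u, r>]. *)
Lemma inv_max_prefix w r u : inv w r -> (forall t, inv w t -> len t <= len r) ->
  inv (r * w) u -> inv w u.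
Proof.
move=> wr rmax rwu; have rr := inv_refl wr; have ru := inv_refl rwu.
have [eur|nur] := pselect (u = r).
  by rewrite eur.
have [a [b [[_ ra Ia] [_ rb Ib] _ DE]]] := dsimple_pair ru rr nur.
have u2 := refl2 ru; have r2 := refl2 rr.
(* Choose [v] in the subgroup with [v^-1 * w] shortest. This cofactor has no inversion in the
   subgroup, so there the inversions of [w] are those of [v]. *)
have ex : exists n, `[< exists v, dih u r v /\ len (v^-1 * w) = n >].
  exists (len w); apply/asboolP; exists 1; rewrite invg1 mul1g; split=> //.
  by exists 0%N; left.
case: (ex_minnP ex) => n /asboolP[v [Dv vn]] nmin.
pose x := v^-1 * w; have wE : w = v * x by rewrite /x mulVKg.
have Ix t : dih u r t -> inv x t = false.
  move=> Dt; apply/negP => xt; have := inv_lt xt; rewrite /x vn ltnNge.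
  apply/negP/negPn/nmin/asboolP; exists (v * t^-1); split; last first.
    by rewrite invgM invgK mulgA.
  by apply: dihM => //; exact: dihV.
have Iv y t : dih u r y -> dih u r t -> inv (y * x) t = inv y t.
  by move=> Dy Dt; rewrite invM Ix ?addbF //; exact: dihJ.
have Du := dihl u r; have Dr := dihr u r.
rewrite wE Iv //; apply: (@dih_prefix a b v r u) => //.
- by move=> t /DE; exact: Ia.
- by move=> t /DE; exact: Ib.
- exact/DE.
- exact/DE.
- by rewrite -Iv // -wE.
- by move=> t /DE Dt; rewrite -Iv // -wE; exact: rmax.
- exact/DE.
- by rewrite -Iv //; [rewrite -mulgA -wE | exact: dihM].
Qed.

End Dihedral.

(** * The shortlex order on words *)

Section Shortlex.
Variable S : finType.
Implicit Types (u v w : seq S).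

Lemma lexle_total u v : lexle u v || lexle v u.
Proof.
elim: u v => [|a u IH] [|b v] //=; rewrite (eq_sym b a).
have := IH v; case: (a =P b) => [->|ne]; first by rewrite ltnn.
rewrite !orbF -neq_ltn => _; apply/eqP => /ord_inj/enum_rank_inj; exact: ne.
Qed.

Lemma lexle_anti u v : size u = size v -> lexle u v -> lexle v u -> u = v.
Proof.
elim: u v => [|a u IH] [|b v] //= [sz]; rewrite (eq_sym b a).
case: (a =P b) => [->|_]; last by rewrite !orbF => h /ltnW; rewrite leqNgt h.
by rewrite ltnn /= => uv vu; rewrite (IH v).
Qed.

Lemma lexle_trans v u w : lexle u v -> lexle v w -> lexle u w.
Proof.
elim: u v w => [|a u IH] [|b v] [|c w] //=.
move=> /orP[ab|/andP[/eqP -> uv]] /orP[bc|/andP[/eqP <- vw]].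
- by rewrite (ltn_trans ab bc).
- by rewrite ab.
- by rewrite bc.
- by rewrite eqxx (IH _ _ uv vw) orbT.
Qed.

Lemma shortlex_total u v : shortlex_le u v || shortlex_le v u.
Proof.
rewrite /shortlex_le; case: (ltngtP (size u) (size v)) => //= _.
exact: lexle_total.
Qed.

Lemma shortlex_anti u v : shortlex_le u v -> shortlex_le v u -> u = v.
Proof.
rewrite /shortlex_le; case: (ltngtP (size u) (size v)) => //= e.
exact: lexle_anti.
Qed.

Lemma shortlex_size u v : shortlex_le u v -> size u <= size v.
Proof. by case/orP=> [/ltnW|/andP[/eqP ->]]. Qed.

Lemma shortlex_trans v u w : shortlex_le u v -> shortlex_le v w -> shortlex_le u w.
Proof.
rewrite /shortlex_le => /orP[uv|/andP[/eqP -> uv]] /orP[vw|/andP[/eqP <- vw]].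
- by rewrite (ltn_trans uv vw).
- by rewrite uv.
- by rewrite vw.
- by rewrite eqxx (lexle_trans uv vw) orbT.
Qed.

Lemma lexle_min n (P : seq S -> Prop) : (exists w, size w = n /\ P w) ->
  exists w, [/\ size w = n, P w & forall w', size w' = n -> P w' -> lexle w w'].
Proof.
elim: n P => [|n IH] P [w [sw Pw]].
  by exists [::]; split=> //; move: Pw; rewrite (size0nil sw).
have ex : exists k, `[< exists s u,
    [/\ nat_of_ord (enum_rank s) = k, size u = n & P (s :: u)] >].
  case: w sw Pw => // s u [su] Pw; exists (enum_rank s).
  by apply/asboolP; exists s, u.
case: (ex_minnP ex) => k /asboolP[s [u [rs su Psu]]] kmin.
have [|v [sv Pv vmin]] := IH (fun v => P (s :: v)); first by exists u.
exists (s :: v); split=> //=; first by rewrite sv.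
case=> // s' v' [sv'] Pv'.
have : k <= enum_rank s' by apply: kmin; apply/asboolP; exists s', v'.
rewrite -rs leq_eqVlt => /orP[/eqP/ord_inj/enum_rank_inj e|->//].
by rewrite e eqxx vmin ?orbT // e.
Qed.

Lemma shortlex_min (P : seq S -> Prop) : (exists w, P w) ->
  exists w, P w /\ forall w', P w' -> shortlex_le w w'.
Proof.
move=> [w Pw]; have ex : exists n, `[< exists w, size w = n /\ P w >].
  by exists (size w); apply/asboolP; exists w.
case: (ex_minnP ex) => n /asboolP /lexle_min[v [sv Pv vmin]] nmin.
exists v; split=> // w' Pw'; rewrite /shortlex_le sv.
have : n <= size w' by apply: nmin; apply/asboolP; exists w'.
by rewrite leq_eqVlt => /orP[/eqP e|->//]; rewrite -e eqxx vmin ?orbT.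
Qed.

End Shortlex.

(** * Parabolic subgroups, shortest coset representatives and sphericity *)

Section Parabolic.
Variables (S : finType) (m : S -> S -> nat) (mP : coxeter_matrix m).
Local Notation G := (coxgroup mP).
Local Notation wd := (wd mP).
Local Notation gen := (gen mP).
Implicit Types (x y z t a v : G) (w c : seq S) (s : S) (U V : {set S}).
Local Open Scope group_scope.

Definition inP U x := exists w, all (mem U) w /\ wd w = x.

Lemma inP1 U : inP U 1.
Proof. by exists [::]. Qed.

Lemma inPM U x y : inP U x -> inP U y -> inP U (x * y).
Proof.
move=> [w [Uw <-]] [w' [Uw' <-]]; exists (w ++ w').
by rewrite all_cat Uw Uw' wd_cat.
Qed.

Lemma inPV U x : inP U x -> inP U x^-1.
Proof. by move=> [w [Uw <-]]; exists (rev w); rewrite all_rev wd_rev. Qed.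

Lemma inP_gen U s : s \in U -> inP U (gen s).
Proof. by move=> Us; exists [:: s]; rewrite /= Us. Qed.

Lemma inP_sub U V x : U \subset V -> inP U x -> inP V x.
Proof.
move=> /fintype.subsetP UV [w [Uw wx]]; exists w; split=> //.
by apply: sub_all Uw => s; exact: UV.
Qed.

Lemma inP0 x : inP finset.set0 x -> x = 1.
Proof. by case=> -[|s w] [] //=; rewrite inE. Qed.

(** When a new letter does not lengthen the element, the exchange condition deletes a letter
    instead, so the word stays in [U]. *)
Lemma inP_red U x : inP U x -> exists w, [/\ all (mem U) w, red mP w & wd w = x].
Proof.
case=> w [Uw <-] {x}; elim/last_ind: w Uw => [|w s IH] Uw.
  by exists [::]; rewrite /red /= wd0 len1.
move: Uw; rewrite all_rcons => /andP[Us /IH[w' [Uw' rw' e]]].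
rewrite wd_rcons -e; case: (boolP (desc (wd w') s)) => d; last first.
  exists (rcons w' s); rewrite all_rcons Us Uw' /red size_rcons wd_rcons.
  by rewrite len_asc // (eqP rw').
have := d; rewrite descE inv_red // => /rl_delete[w'' [sub sz]].
rewrite conj_genM => ew; exists w''; rewrite /red ew; split=> //.
  by apply/allP => y /(mem_subseq sub)/(allP Uw').
by rewrite -eqSS sz (eqP rw') len_desc.
Qed.

Lemma inP_inv U x t : inP U x -> inv x t -> inP U t.
Proof.
move=> /inP_red[w [Uw rw <-]]; rewrite inv_red // => /rl_split[u [s [v [e ->]]]].
move: Uw; rewrite e all_cat /= => /and3P[Uu Us _].
rewrite conjgE invgK; apply: inPM; first by exists u.
by apply: inPM; [exact: inP_gen | apply: inPV; exists u].
Qed.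

(* If [v] is a suffix of [x] and [v s > v], the exchange for the descent [s]
   of [x] cannot happen inside [v]; so [v s] is a suffix of [x] as well. *)
Lemma len_all_desc U x v : (forall s, s \in U -> desc x s) -> inP U v ->
  len (x * v^-1) + len v = len x.
Proof.
move=> dx /inP_red[w [Uw rw <-]] {v}.
elim/last_ind: w Uw rw => [|w s IH] Uw rw.
  by rewrite wd0 invg1 mulg1 len1 addn0.
move: Uw; rewrite all_rcons => /andP[Us Uw].
have {}rw : red mP w /\ ~~ desc (wd w) s.
  move: rw; rewrite /red size_rcons wd_rcons => /eqP rw.
  have l1 := len_wd mP w; have l2 := lenM (wd w) (gen s).
  by rewrite /desc; move: l2; rewrite len_gen; split; lia.
have {IH} := IH Uw rw.1; rewrite wd_rcons len_asc ?rw.2 //.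
set v := wd w; set x' := x * v^-1 => IH.
have xE : x = x' * v by rewrite /x' mulgVK.
have := dx _ Us; rewrite descE => /[dup] hx; rewrite {1}xE => /inv_mul_or[h|h].
  have := inv_lt h; have -> : gen s ^ x^-1 * x' = x * (v * gen s)^-1.
    by rewrite /x' mulgA conj_genM invgM genV mulgA.
  have := lenM (x * (v * gen s)^-1) (v * gen s); rewrite mulgVK.
  rewrite (len_asc rw.2) -/v; move: IH; rewrite -/x'; lia.
case/negP: rw.2; rewrite descE -/v; move: h.
by rewrite -conjgM {1}xE invgM -mulgA mulVg mulg1.
Qed.

(** Induction along a reduced word of [v]. The exchange for a descent of [a * v] would take place
    inside [v], whose extended word is reduced, or inside [a], producing a shorter element of the
    coset. *)
Lemma len_coset_min U a v : (forall z, inP U z -> len a <= len (a * z)) ->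
  inP U v -> len (a * v) = len a + len v.
Proof.
move=> amin /inP_red[w [Uw rw <-]] {v}.
elim/last_ind: w Uw rw => [|w s IH] Uw rw.
  by rewrite wd0 mulg1 len1 addn0.
move: Uw; rewrite all_rcons => /andP[Us Uw].
have {}rw : red mP w /\ ~~ desc (wd w) s.
  move: rw; rewrite /red size_rcons wd_rcons => /eqP rw.
  have l1 := len_wd mP w; have l2 := lenM (wd w) (gen s).
  by rewrite /desc; move: l2; rewrite len_gen; split; lia.
rewrite wd_rcons (len_asc rw.2) addnS -IH ?rw.1 //.
set v := wd w; rewrite mulgA; apply: len_asc; apply/negP; rewrite descE.
case/inv_mul_or=> h.
  have := inv_lt h; rewrite ltnNge => /negP; apply.
  have -> : gen s ^ (a * v)^-1 * a = a * (v * gen s * v^-1).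
    by rewrite invgM conjgM conjgE invgK [gen s ^ _]conjgE invgK -!mulgA mulVg mulg1.
  have Uv : inP U v by exists w.
  by apply: amin; apply: inPM; [apply: inPM => //; exact: inP_gen | exact: inPV].
by case/negP: rw.2; rewrite descE -/v; move: h; rewrite -conjgM invgM -mulgA mulVg mulg1.
Qed.

Lemma in_cosetE U w w' : in_coset m U w w' <-> inP U ((wd w)^-1 * wd w').
Proof.
split=> [[u [Uu /(wdE mP)]]|[u [Uu e]]].
  by rewrite wd_cat => <-; exists u; rewrite mulKg.
by exists u; split=> //; apply/(wdE mP); rewrite wd_cat e mulVKg.
Qed.

Lemma inWE U w : inW m U w <-> inP U (wd w).
Proof.
by split=> -[v [Uv /(wdE mP) e]]; exists v; split=> //; apply/(wdE mP).
Qed.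

Lemma in_coset_refl U w : in_coset m U w w.
Proof. by apply/in_cosetE; rewrite mulVg; exact: inP1. Qed.

Lemma in_coset_sym U w w' : in_coset m U w w' -> in_coset m U w' w.
Proof. by move=> /in_cosetE/inPV; rewrite invgM invgK => /in_cosetE. Qed.

Lemma in_coset_trans U w1 w2 w3 :
  in_coset m U w1 w2 -> in_coset m U w2 w3 -> in_coset m U w1 w3.
Proof.
move=> /in_cosetE h1 /in_cosetE h2; apply/in_cosetE.
by have := inPM h1 h2; rewrite mulgA mulgK.
Qed.

Lemma crepP U w : canon m U (crep m U w) /\ in_coset m U w (crep m U w).
Proof.
have [|c [wc cmin]] := @shortlex_min S (fun c => in_coset m U w c).
  by exists w; exact: in_coset_refl.
apply: (@xgetPex _ [::] [set c | canon m U c /\ in_coset m U w c]%classic).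
exists c; split=> // c' cc'; apply: cmin; exact: in_coset_trans cc'.
Qed.

Lemma canon_uniq U c c' : canon m U c -> canon m U c' -> in_coset m U c c' -> c = c'.
Proof.
by move=> h h' cc'; apply: shortlex_anti; [exact: h | exact/h'/in_coset_sym].
Qed.

Lemma crep_eq U w c : canon m U c -> in_coset m U w c -> crep m U w = c.
Proof.
move=> hc wc; have [h h'] := crepP U w.
by apply: (canon_uniq h) => //; exact: in_coset_trans (in_coset_sym h') wc.
Qed.

Definition crp U x : seq S := crep m U (word x).
Definition rep U x : G := wd (crp U x).

Lemma crp_canon U x : canon m U (crp U x).
Proof. by have [] := crepP U (word x). Qed.
Arguments crp_canon : clear implicits.

Lemma rep_inP U x : inP U (x^-1 * rep U x).
Proof. by have [_ /in_cosetE] := crepP U (word x); rewrite wordK. Qed.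

Lemma rep_inPV U x : inP U ((rep U x)^-1 * x).
Proof. by have := inPV (rep_inP U x); rewrite invgM invgK. Qed.

Lemma crp_wd U w : crp U (wd w) = crep m U w.
Proof.
apply/esym/crep_eq; first exact: crp_canon.
by apply/in_cosetE; rewrite -/(rep U (wd w)); exact: rep_inP.
Qed.

Lemma crp_eq U x c : canon m U c -> inP U (x^-1 * wd c) -> crp U x = c.
Proof. by move=> hc h; apply: crep_eq => //; apply/in_cosetE; rewrite wordK. Qed.

Lemma crp_coset U x y : inP U (x^-1 * y) -> crp U x = crp U y.
Proof.
move=> xy; apply: crp_eq; first exact: crp_canon.
by have := inPM xy (rep_inP U y); rewrite mulgA mulgK.
Qed.

Lemma crp_mulgen U x s : s \in U -> crp U (x * gen s) = crp U x.
Proof. by move=> Us; apply/esym/crp_coset; rewrite mulKg; exact: inP_gen. Qed.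

Lemma canon_crp U c : canon m U c -> crp U (wd c) = c.
Proof. by move=> hc; apply: crp_eq => //; rewrite mulVg; exact: inP1. Qed.

Lemma canon_min U c z : canon m U c -> inP U z -> size c <= len (wd c * z).
Proof.
move=> hc Uz; rewrite -size_rword; apply/shortlex_size/hc/in_cosetE.
by rewrite rwordK mulKg.
Qed.

Lemma canon_red U c : canon m U c -> red mP c.
Proof.
move=> hc; rewrite /red eqn_leq len_wd andbT.
by have := canon_min hc (inP1 U); rewrite mulg1.
Qed.

Lemma len_canon U c v : canon m U c -> inP U v ->
  len (wd c * v) = len (wd c) + len v.
Proof.
move=> hc; apply: len_coset_min => z Uz; rewrite -(eqP (canon_red hc)).
exact: (canon_min hc Uz).
Qed.

Lemma len_rep U x : len x = len (rep U x) + len ((rep U x)^-1 * x).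
Proof.
rewrite -(len_canon (crp_canon U x) (rep_inPV U x)); congr len.
by rewrite mulVKg.
Qed.

(** Cosets of the trivial subgroup are single elements, so this is the shortlex normal form. *)
Definition cword x := crp finset.set0 x.

Lemma cwordK x : wd (cword x) = x.
Proof.
by have /inP0/(canRL (mulKg _)) := rep_inP finset.set0 x; rewrite invgK mulg1.
Qed.

Lemma size_cword x : size (cword x) = len x.
Proof. by rewrite (eqP (canon_red (crp_canon _ x))) cwordK. Qed.

Lemma cword_canon x : canon m finset.set0 (cword x).
Proof. exact: crp_canon. Qed.
Arguments cword_canon : clear implicits.

Lemma cword_wd c : canon m finset.set0 c -> cword (wd c) = c.
Proof. exact: canon_crp. Qed.

Lemma sphericalP U : spherical m U <-> exists L, forall x, inP U x -> len x <= L.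
Proof.
split=> [/finite_seqP[l le]|[L hL]].
  exists (\max_(w <- l) size w) => x Ux; rewrite -size_cword.
  have : (cword x) \in l.
    suff : [set` l]%classic (cword x) by [].
    by rewrite -le; split; [exact: cword_canon | apply/inWE; rewrite cwordK].
  by move=> h; rewrite (big_rem _ h) /= leq_maxl.
apply: (@sub_finite_set _ _ [set` [seq cword x | x <- ball mP L]]%classic); last first.
  exact: finite_seq.
move=> w [cw /inWE Uw] /=; apply/mapP; exists (wd w); last by rewrite cword_wd.
by apply: ballP; exact: hL.
Qed.

Lemma spherical_sub U V : U \subset V -> spherical m V -> spherical m U.
Proof.
move=> UV /sphericalP[L h]; apply/sphericalP; exists L => x /(inP_sub UV).
exact: h.
Qed.

(** By [len_all_desc] every element of [W_U] is a suffix of [x], which bounds its length. *)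
Lemma desc_spherical U x : (forall s, s \in U -> desc x s) -> spherical m U.
Proof.
move=> dx; apply/sphericalP; exists (len x) => v Uv.
by have := len_all_desc dx Uv; lia.
Qed.

End Parabolic.

(** * Folding the group onto finite sets *)

Section Folding.
Variables (S : finType) (m : S -> S -> nat) (mP : coxeter_matrix m).
Local Notation G := (coxgroup mP).
Local Notation gen := (gen mP).
Implicit Types (x y z t r : G) (s : S) (U V : {set S}) (n k : nat).
Local Open Scope group_scope.

(** Shortlex refines the comparison of lengths and makes the maximum unique; uniqueness is what
    relates the folds of [x] and [x * gen s]. *)
Definition maxinv x r := inv x r /\
  forall t, inv x t -> shortlex_le (cword t) (cword r).

Lemma maxinv_ex x : x <> 1 -> exists r, maxinv x r.
Proof.
move=> x1; suff [r rx rmax] : exists2 r, r \in rl mP (rword x) &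
    forall t, t \in rl mP (rword x) -> shortlex_le (cword t) (cword r).
  by exists r; split=> [|t]; rewrite inv_rword //; exact: rmax.
have : rl mP (rword x) != [::].
  rewrite -size_eq0 size_rl size_rword; apply/eqP => /len_eq0; exact: x1.
elim: (rl mP (rword x)) => // t l IH _; have [->|/IH[r rl rmax]] := eqVneq l [::].
  exists t; first by rewrite inE.
  by move=> t'; rewrite inE => /eqP ->; rewrite -(orbb (shortlex_le _ _)) shortlex_total.
case/orP: (shortlex_total (cword t) (cword r)) => h.
  exists r; first by rewrite inE rl orbT.
  by move=> t'; rewrite inE => /orP[/eqP ->|/rmax].
exists t; first by rewrite inE eqxx.
move=> t'; rewrite inE => /orP[/eqP ->|/rmax h']; last exact: shortlex_trans h' h.
by rewrite -(orbb (shortlex_le _ _)) shortlex_total.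
Qed.

Definition mxi x := xget 1 [set r | maxinv x r].

Lemma mxiP x : x <> 1 -> maxinv x (mxi x).
Proof. by move=> /maxinv_ex h; exact: (xgetPex 1 h). Qed.

Lemma maxinv_uniq x r : maxinv x r -> mxi x = r.
Proof.
move=> h; have [|h1 h2] := @mxiP x.
  by move=> x1; case: h; rewrite x1 inv1.
have := shortlex_anti (h.2 _ h1) (h2 _ h.1) => /(congr1 (wd mP)).
by rewrite !cwordK.
Qed.

Lemma maxinv_len x r t : maxinv x r -> inv x t -> len t <= len r.
Proof. by move=> h /h.2/shortlex_size; rewrite !size_cword. Qed.

Definition small n x := `[< forall t, inv x t -> len t <= n >].

Lemma small1 n : small n 1.
Proof. by apply/asboolP => t; rewrite inv1. Qed.

Lemma notsmall n x : ~~ small n x -> maxinv x (mxi x) /\ n < len (mxi x).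
Proof.
move=> nx; have h : maxinv x (mxi x).
  by apply: mxiP => x1; move: nx; rewrite x1 small1.
split=> //; rewrite ltnNge; apply: contra nx => ln; apply/asboolP => t xt.
exact: leq_trans (maxinv_len h xt) ln.
Qed.

(** The fuel [len x] suffices, because multiplying by an inversion shortens the element. *)
Fixpoint fold_fuel n k x :=
  if k is k'.+1 then
    if small n x then x else fold_fuel n k' (mxi x * x)
  else x.

Definition fold n x := fold_fuel n (len x) x.

Lemma fold_fuelE n k k' x : len x <= k -> len x <= k' ->
  fold_fuel n k x = fold_fuel n k' x.
Proof.
elim: k k' x => [|k IH] [|k'] x //=.
- by rewrite leqn0 => /eqP/len_eq0 ->; rewrite small1.
- by move=> _; rewrite leqn0 => /eqP/len_eq0 ->; rewrite small1.
move=> lk lk'; case: (boolP (small n x)) => // /notsmall[[/inv_lt h _] _].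
by apply: IH; rewrite -ltnS; exact: leq_trans h _.
Qed.

Lemma fold_small n x : small n x -> fold n x = x.
Proof. by rewrite /fold; case: (len x) => //= k ->. Qed.

Lemma foldE n x : ~~ small n x -> fold n x = fold n (mxi x * x).
Proof.
move=> nx; have [[/inv_lt h _] _] := notsmall nx.
rewrite {1}/fold; case e : (len x) => [|k] /=; first by rewrite e in h.
by rewrite (negbTE nx); apply: fold_fuelE => //; rewrite -ltnS -e.
Qed.

Lemma fold_ind n (P : G -> G -> Prop) : (forall x, small n x -> P x x) ->
  (forall x, ~~ small n x -> maxinv x (mxi x) -> P (mxi x * x) (fold n x) ->
     P x (fold n x)) -> forall x, P x (fold n x).
Proof.
move=> Ps Pm x; have [k] := ubnP (len x); elim: k x => // k IH x lk.
have [sx|nx] := boolP (small n x); first by rewrite fold_small //; exact: Ps.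
have [mx _] := notsmall nx; apply: Pm => //; rewrite foldE //; apply: IH.
exact: leq_trans (inv_lt mx.1) lk.
Qed.

Lemma small_fold n x : small n (fold n x).
Proof. exact: (@fold_ind n (fun _ y => small n y)). Qed.

Lemma fold_inv n x t : inv (fold n x) t -> inv x t.
Proof.
apply: (@fold_ind n (fun x y => inv y t -> inv x t)) => // {}x _ mx IH /IH.
by apply: inv_max_prefix mx.1 _ => t'; exact: maxinv_len.
Qed.

Lemma fold_inP n U x : inP U x -> inP U (fold n x).
Proof.
apply: (@fold_ind n (fun x y => inP U x -> inP U y)) => // {}x _ mx IH Ux.
by apply: IH; apply: inPM => //; exact: inP_inv mx.1.
Qed.

Lemma small_le n x : (len x).*2 <= n -> small n x.
Proof.
by move=> xn; apply/asboolP => t /inv_conj_len h; lia.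
Qed.

(** The length is the number of inversions, and these all lie in a ball. *)
Lemma small_len n x : small n x -> len x <= size (ball mP n).
Proof.
move/asboolP => sx; rewrite -size_rword -(size_rl mP).
apply: uniq_leq_size; first exact/uniq_rl/red_rword.
by move=> t; rewrite -inv_rword => /sx/ballP.
Qed.

(** The inversions of [x * gen s] are those of [x] together with [mu]. If [mu] is the largest, the
    first folding step leads back to [x]. Otherwise both elements have the same largest inversion,
    and the induction continues after multiplying both by it. *)
Lemma fold_asc n x s : ~~ desc x s ->
  fold n (x * gen s) = fold n x \/ fold n (x * gen s) = fold n x * gen s.
Proof.
have [k] := ubnP (len x); elim: k x => // k IH x lk ds.
pose mu := gen s ^ x^-1; have xmu : ~~ inv x mu by rewrite -descE.
have invE t : inv (x * gen s) t = inv x t || (t == mu).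
  rewrite inv_mulgen -/mu; case: (t =P mu) => [->|_]; last by rewrite addbF orbF.
  by rewrite (negbTE xmu).
have [sxs|nxs] := boolP (small n (x * gen s)).
  right; rewrite !fold_small //; apply/asboolP => t xt.
  by move/asboolP: sxs; apply; rewrite invE xt.
have [[ms mmax] mn] := notsmall nxs; rewrite foldE //.
move: ms; rewrite invE => /orP[mx|/eqP ->]; last first.
  left; congr fold; rewrite /mu mulgA conj_genM; exact: genK.
have mE : mxi x = mxi (x * gen s).
  by apply: maxinv_uniq; split=> // t xt; apply: mmax; rewrite invE xt.
have nx : ~~ small n x.
  by apply: contraL mn => /asboolP sx; rewrite -leqNgt; exact: sx.
rewrite (foldE nx) mE mulgA; set y := mxi _ * x.
have ly : len y < len x by exact: inv_lt.
(* The multiplication may turn the ascent into a descent; the induction hypothesis then applies to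
   [y * gen s], with the two elements exchanged. *)
case: (boolP (desc y s)) => dy; last by apply: IH => //; lia.
have [] := IH (y * gen s); rewrite ?desc_mulgen ?dy ?genK //.
- by rewrite -ltnS (len_desc dy); exact: ltn_trans ly lk.
- by left.
- by move=> ->; right; rewrite genK.
Qed.

Lemma fold_mulgen n x s :
  fold n (x * gen s) = fold n x \/ fold n (x * gen s) = fold n x * gen s.
Proof.
case: (boolP (desc x s)) => dx; last exact: fold_asc.
have := @fold_asc n (x * gen s) s; rewrite desc_mulgen dx genK => /(_ isT).
by case=> ->; [left|right; rewrite genK].
Qed.

End Folding.

(** * Exactness of the complex of finitely supported functions *)

Section FiniteExactness.
Variables (R : realType) (S : finType) (m : S -> S -> nat).
Variables (mP : coxeter_matrix m) (T : {set S}).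
Local Notation G := (coxgroup mP).
Local Notation gen := (gen mP).
Implicit Types (x y z : G) (s t : S) (U V : {set S}) (c g : {set S} -> G -> R).
Local Open Scope ring_scope.

Lemma eps_self s V : eps R s (s |: V) = eps R s V.
Proof.
congr (_ ^+ _); apply: eq_card => t; rewrite !inE.
by case: (t =P s) => [->|//]; rewrite ltnn !andbF.
Qed.

Lemma epsU1 s t V : t \notin V ->
  eps R s (t |: V) = eps R s V * (if (enum_rank t < enum_rank s)%N then -1 else 1).
Proof.
move=> tV; rewrite /eps; case: ifP => lt; last first.
  rewrite mulr1; congr (_ ^+ _); apply: eq_card => x; rewrite !inE.
  by case: (x =P t) => [->|//]; rewrite lt !andbF.
rewrite -exprSr; congr (_ ^+ _).
rewrite (_ : finset _ = t |: finset (fun x : S =>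
  (x \in V) && (enum_rank x < enum_rank s)%N)).
  by rewrite cardsU1 inE (negbTE tV).
by apply/setP => x; rewrite !inE; case: (x =P t) => [->|//]; rewrite lt.
Qed.

Lemma eps_sq s V : eps R s V * eps R s V = 1.
Proof. by rewrite -expr2 sqrr_sign. Qed.

(** Adding [t] changes the sign of [s] exactly when [t] precedes [s], and exactly one of two
    distinct elements precedes the other. *)
Lemma eps_swap s t U : s \notin U -> t \notin U -> s != t ->
  eps R s (s |: (t |: U)) * eps R t (t |: U) =
  - (eps R t (s |: (t |: U)) * eps R s (s |: U)).
Proof.
move=> sU tU st; rewrite !eps_self finset.setUCA eps_self !epsU1 //.
have : (enum_rank t < enum_rank s)%N = ~~ (enum_rank s < enum_rank t)%N.
  have ne : (enum_rank t : nat) != enum_rank s.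
    by apply: contraNN st => /eqP e; apply/eqP/esym/enum_rank_inj/val_inj.
  by rewrite -leqNgt ltn_neqAle ne.
by move=> ->; case: (_ < _)%N; rewrite /= !(mulr1, mulrN1, mulNr, opprK) mulrC.
Qed.

Definition bd c U x := \sum_(s | s \notin U) eps R s (s |: U) * c (s |: U) x.

(** Exchanging the two summations turns the double sum into its opposite, by [eps_swap]. *)
Lemma bd_bd c U x : bd (bd c) U x = 0.
Proof.
set A := LHS; suff : A = - A.
  by move/eqP; rewrite -addr_eq0 -mulr2n mulrn_eq0 /= => /eqP.
pose F s t := eps R s (s |: U) *
  (eps R t (t |: (s |: U)) * c (t |: (s |: U)) x).
have AE : A = \sum_(s | s \notin U) \sum_(t | t \notin s |: U) F s t.
  by apply: eq_bigr => s _; rewrite /bd mulr_sumr.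
rewrite {1}AE (exchange_big_dep (fun t => t \notin U)) /=; last first.
  by move=> s t _; rewrite !inE negb_or => /andP[].
rewrite AE -sumrN; apply: eq_bigr => t tU; rewrite -sumrN.
rewrite (eq_bigl (fun s => s \notin t |: U)); last first.
  by move=> s; rewrite !inE !negb_or tU andbT eq_sym andbC.
apply: eq_bigr => s; rewrite !inE negb_or => /andP[st sU].
rewrite /F mulrA [X in X * _]mulrC eps_swap // 1?eq_sym // mulNr; congr (- _).
by rewrite finset.setUCA mulrA [X in _ = X * _]mulrC.
Qed.

Lemma bdD c g U x : bd (fun V y => c V y + g V y) U x = bd c U x + bd g U x.
Proof. by rewrite -big_split; apply: eq_bigr => s _; rewrite mulrDr. Qed.

Lemma bdB c g U x : bd (fun V y => c V y - g V y) U x = bd c U x - bd g U x.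
Proof. by rewrite -sumrB; apply: eq_bigr => s _; rewrite mulrBr. Qed.

(* Chains of degree [i], with finite support: the vanishing beyond length [L]
   amounts to it since balls are finite. *)
Definition chain i L c := [/\ forall U x, c U x != 0 -> T \subset U /\ #|U| = i,
  forall U s x, s \in U -> c U (x * gen s)%g = c U x
  & forall U x, (L <= len x)%N -> c U x = 0].

Section TopLayer.
Variables (i L : nat) (c : {set S} -> G -> R).
Hypotheses (Ti : (#|T| < i)%N) (hc : chain i L.+1 c).
Hypothesis cyc : forall U x, T \subset U -> bd c U x = 0.

(** By its descents, [x] is the longest element of the coset [y W_V]; its length is required to be
    exactly [L]. *)
Definition top V y x :=
  [/\ inP V (y^-1 * x)%g, len x = L & forall s, s \in V -> desc x s].

Lemma top_len V y x : top V y x -> (len y + len (y^-1 * x)%g = L)%N.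
Proof.
case=> Vx <- dx; rewrite -(len_all_desc dx Vx); congr (len _ + _)%N.
by rewrite invgM invgK mulVKg.
Qed.

Lemma top_uniq V y x x' : top V y x -> top V y x' -> x = x'.
Proof.
move=> hx [Vx' lx' dx']; have [Vx lx dx] := hx.
have Vz : inP V (x'^-1 * x)%g.
  by have := inPM (inPV Vx') Vx; rewrite invgM invgK mulgA mulgK.
have := len_all_desc dx Vz; rewrite invgM invgK mulVKg lx lx'.
rewrite -[X in _ = X]addn0 => /addnI/len_eq0/(canRL (mulKg _)).
by rewrite invgK mulg1.
Qed.

Lemma top_self V y : len y = L -> (forall s, s \in V -> desc y s) -> top V y y.
Proof. by move=> ly dy; split=> //; rewrite mulVg; exact: inP1. Qed.

Lemma top_eq V y x : len y = L -> top V y x -> x = y.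
Proof.
move=> ly h; have := top_len h; rewrite ly -[X in _ = X]addn0 => /addnI.
by move/len_eq0/(canRL (mulKg _)); rewrite invgK mulg1.
Qed.

(** The apex of the cone that contracts the part of the complex carried by [x]: a descent outside
    [T], chosen independently of [V]. *)
Definition sel x := [pick s | desc x s && (s \notin T)].

Definition tval V x : R := if sel x is Some s then
    if s \in V then eps R s V * c (V :\ s) x else 0 else 0.

(** The cone construction [tval] at the longest element, spread over the whole coset to make it
    right [W_V]-invariant. *)
Definition gtop V y : R :=
  if `[< exists x, top V y x >] then tval V (xget 1%g [set x | top V y x]%classic)
  else 0.

Lemma gtopE V y x : top V y x -> gtop V y = tval V x.
Proof.
move=> h; have ex : exists x, top V y x by exists x.
rewrite /gtop asboolT //; congr tval.
by apply: (top_uniq _ h); exact: (xgetPex 1%g ex).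
Qed.

Lemma gtop_neq0 V y : gtop V y != 0 -> exists2 x, top V y x & tval V x != 0.
Proof.
rewrite /gtop; case: asboolP => [[x h]|]; last by rewrite eqxx.
move=> n; exists x => //; move: n; have := gtopE h.
by rewrite /gtop asboolT => [->//|]; exists x.
Qed.

Lemma gtop_chain : chain i.+1 L.+1 gtop.
Proof.
have [sc _ _] := hc; split.
- move=> V y /gtop_neq0[x _]; rewrite /tval /sel; case: pickP => [s|_]; last first.
    by rewrite eqxx.
  case/andP=> _ sT; case: ifP => [sV|_]; last by rewrite eqxx.
  rewrite mulf_eq0 negb_or => /andP[_ /sc[TV cV]]; split.
    by apply: (fintype.subset_trans TV); exact: subD1set.
  by rewrite (cardsD1 s) sV cV.
- move=> V s y Vs; have topE x : top V (y * gen s)%g x <-> top V y x.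
    have Vg : inP V (gen s) by exact: inP_gen.
    have e : ((y * gen s)^-1 * x = gen s * (y^-1 * x))%g.
      by rewrite invgM genV mulgA.
    rewrite /top e; split=> -[Vx lx dx]; split=> //; last exact: inPM.
    by rewrite -(mulKg (gen s) (y^-1 * x)%g) genV; exact: inPM.
  have e : top V (y * gen s)%g = top V y by apply/funext => x; apply/propext.
  by rewrite /gtop e.
- move=> V y ly; apply/eqP; apply: contraTT ly => /gtop_neq0[x /top_len h _].
  by rewrite -ltnNge ltnS -h leq_addr.
Qed.

Lemma gtop_spherical V y : gtop V y != 0 -> spherical m V.
Proof. by case/gtop_neq0=> x [_ _ dx] _; exact: desc_spherical dx. Qed.

Lemma chain_desc U y s : len y = L -> c U y != 0 -> s \in U -> desc y s.
Proof.
case: hc => _ ci cL ly n Us; apply: contraTT n => ds.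
by rewrite -(ci _ _ _ Us) cL ?eqxx // len_asc // ly.
Qed.

Lemma gtop_len V y : len y = L ->
  gtop V y = if [forall s in V, desc y s] then tval V y else 0.
Proof.
move=> ly; case: ifP => [/forallP h|/negbT h].
  by apply/gtopE/top_self => // s Vs; have := h s; rewrite Vs.
apply/eqP; apply: contraTT h => /gtop_neq0[x hx _]; rewrite negbK.
have e := top_eq ly hx; rewrite e in hx.
by apply/forallP => s; apply/implyP => Vs; case: hx => _ _; apply.
Qed.

(** The homotopy identity of a cone with apex [t]. If [t] is not in [U], only the term of [t]
    survives; if it is, the cycle condition at [U :\ t] gives the value. Without an apex all
    descents lie in [T], so [c U y] is zero because [#|T| < i]. *)
Lemma bd_gtop U y : T \subset U -> len y = L -> bd gtop U y = c U y.
Proof.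
move=> TU ly; rewrite /bd; under eq_bigr do rewrite gtop_len // /tval.
case e : (sel y) => [t|]; last first.
  rewrite big1 => [|s _]; last by case: ifP => _; rewrite mulr0.
  apply/esym/eqP; apply: contraPT e => n; have [sc _ _] := hc.
  have [_ cU] := sc _ _ n; rewrite /sel; case: pickP => // none.
  have : U \subset T.
    apply/fintype.subsetP => s Us; have := none s.
    by rewrite (chain_desc ly n Us) /= => /negbFE.
  by move/subset_leq_card; rewrite cU leqNgt Ti.
have [dt tT] : desc y t /\ t \notin T.
  by move: e; rewrite /sel; case: pickP => // s /andP[ds sT] [<-].
have [tU|tU] := boolP (t \in U); last first.
  rewrite (bigD1 t) //= big1 ?addr0 => [|s /andP[sU st]]; last first.
    by rewrite !inE eq_sym (negbTE st) (negbTE tU) /=; case: ifP; rewrite mulr0.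
  rewrite setU11 setU1K //; case: ifP => [_|/negbT h].
    by rewrite mulrA eps_sq mul1r.
  rewrite mulr0; apply/esym/eqP; apply: contraTT h => n; rewrite negbK.
  apply/forallP => s; apply/implyP; rewrite !inE => /orP[/eqP ->//|].
  exact: chain_desc ly n.
pose U' := U :\ t.
have UE : U = t |: U' by rewrite finset.setD1K.
have tU' : t \notin U' by rewrite !inE eqxx.
have TU' : T \subset U'.
  by apply/fintype.subsetP => s Ts; rewrite !inE (fintype.subsetP TU) // andbT;
    apply: contraNneq tT => <-.
(* The cycle condition at [U'] expresses [c U y] through the other cofaces of [U']. *)
have := cyc y TU'; rewrite /bd (bigD1 t) //= -UE => /eqP.
rewrite addrC addr_eq0 => /eqP h.
have -> : c U y = - (eps R t U * - (eps R t U * c U y)).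
  by rewrite mulrN opprK mulrA eps_sq mul1r.
rewrite -h mulr_sumr -sumrN; apply: eq_big => [s|s sU].
  rewrite !inE negb_and negbK; case: (s =P t) => [->|_]; last by rewrite andbT.
  by rewrite tU.
have st : s != t by apply: contraNneq sU => ->.
have sU' : s \notin U' by rewrite !inE negb_and (negbTE sU) orbT.
have vE : (s |: U) :\ t = s |: U'.
  apply/setP => x; rewrite !inE; case: (x =P t) => [->|//].
  by rewrite (eq_sym t) (negbTE st).
rewrite !inE tU orbT vE.
(* If some element of [s |: U] is not a descent of [y], it lies in [s |: U'], because [t] is a
   descent; then [c (s |: U') y] is zero by [chain_desc]. *)
have -> : (if [forall s0 in s |: U, desc y s0] then
    eps R t (s |: U) * c (s |: U') y else 0) = eps R t (s |: U) * c (s |: U') y.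
  case: ifP => // /negbT k; apply/esym/eqP; rewrite mulf_eq0; apply/orP; right.
  apply: contraTT k => n; rewrite negbK; apply/forallP => x; apply/implyP.
  rewrite !inE => xs; have [->//|xt] := eqVneq x t.
  by apply: (chain_desc ly n); rewrite !inE xt.
rewrite !mulrA -mulNr; congr (_ * _).
have ACBD := eps_swap sU' tU' st; rewrite -UE in ACBD.
have BB := eps_sq t (s |: U); have CC := eps_sq t U.
set A := eps R s (s |: U) in ACBD *; set D := eps R s (s |: U') in ACBD *.
set B := eps R t (s |: U) in BB ACBD *; set C := eps R t U in CC ACBD *.
transitivity (A * C * (B * C)); first by rewrite mulrACA CC mulr1.
by rewrite ACBD; transitivity (- (B * B * (C * D))); [ring | rewrite BB mul1r].
Qed.

End TopLayer.

(** Induction on the length bound: subtracting the boundary of [gtop] removes the longest elements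
    of the support. *)
Lemma finite_exact i L c : (#|T| < i)%N -> chain i L c ->
  (forall U x, T \subset U -> bd c U x = 0) ->
  exists g, [/\ chain i.+1 L g, forall V x, g V x != 0 -> spherical m V
    & forall U x, T \subset U -> bd g U x = c U x].
Proof.
move=> Ti; elim: L c => [|L IH] c hc cyc.
  have c0 U x : c U x = 0 by have [_ _ ->] := hc.
  exists (fun _ _ => 0); split=> [|V x|U x _]; last 2 first.
  - by rewrite eqxx.
  - by rewrite /bd big1 ?c0 // => s _; rewrite mulr0.
  by split=> // U x; rewrite eqxx.
have [sg ig lg] := gtop_chain hc.
pose g0 := gtop L c.
(* The boundary of [g0] may be nonzero at types that do not contain [T]; the truncation passes to
   the relative complex. *)
pose c' U x := if T \subset U then c U x - bd g0 U x else 0.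
have [sc ic lc] := hc.
have hc' : chain i L c'.
  split.
  - move=> U x; rewrite /c'; case: ifP => [TU|_]; last by rewrite eqxx.
    move=> n; split=> //; have [/eqP c0|/sc[]//] := boolP (c U x == 0).
    move: n; rewrite c0 sub0r oppr_eq0 => n.
    have [s sU gs] : exists2 s, s \notin U & g0 (s |: U) x != 0.
      apply: contrapT => h; case/negP: n; apply/eqP/big1 => s sU.
      by apply/eqP; rewrite mulf_eq0; apply/orP; right; apply/negP => /negP k;
        apply: h; exists s.
    by have [_] := sg _ _ gs; rewrite cardsU1 sU => -[].
  - move=> U s x Us; rewrite /c'; case: ifP => // _; rewrite ic //; congr (_ - _).
    by apply: eq_bigr => t _; congr (_ * _); apply: ig; rewrite !inE Us orbT.
  - move=> U x lx; rewrite /c'; case: ifP => // TU.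
    move: lx; rewrite leq_eqVlt => /orP[/eqP lx|lx].
      by rewrite (bd_gtop Ti hc cyc) ?subrr.
    by rewrite lc // sub0r /bd big1 ?oppr0 // => s _; rewrite /g0 lg ?mulr0.
have [|g1 [[sg1 ig1 lg1] sp1 bd1]] := IH c' hc'.
  move=> U x TU; rewrite -[RHS](subrr 0) -{1}(cyc U x TU) -(bd_bd g0 U x) -bdB.
  apply: eq_bigr => s _; rewrite /c' (fintype.subset_trans TU) //.
  exact: finset.subsetUr.
exists (fun V x => g0 V x + g1 V x); split.
- split.
  + move=> U x; have [/eqP -> |/sg //] := boolP (g0 U x == 0).
    by rewrite add0r => /sg1.
  + by move=> U s x Us; rewrite /g0 ig // ig1.
  + by move=> U x lx; rewrite /g0 lg // lg1 ?addr0 // ltnW.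
- move=> V x; have [/eqP -> |/gtop_spherical //] := boolP (g0 V x == 0).
  by rewrite add0r => /sp1.
- by move=> U x TU; rewrite bdD bd1 // /c' TU addrC subrK.
Qed.

End FiniteExactness.

(** * Absolutely summable families and the Cauchy-Schwarz inequality *)

Section AbsoluteSums.
Variables (R : realType) (I : choiceType).
Implicit Types (a b phi psi : I -> R) (k l : R).
Local Open Scope ring_scope.

Definition es a : \bar R := (\esum_(x in [set: I]) (a x)%:E)%E.

Lemma es_ge0 a : (forall x, 0 <= a x) -> (0 <= es a)%E.
Proof. by move=> a0; apply: esum_ge0 => x _; rewrite lee_fin. Qed.

Lemma le_es a b : (forall x, a x <= b x) -> (es a <= es b)%E.
Proof. by move=> ab; apply: le_esum => x _; rewrite lee_fin. Qed.

Lemma eq_es a b : a =1 b -> es a = es b.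
Proof. by move=> ab; apply: eq_esum => x _; rewrite ab. Qed.

Lemma esD a b : (forall x, 0 <= a x) -> (forall x, 0 <= b x) ->
  es (fun x => a x + b x) = (es a + es b)%E.
Proof.
move=> a0 b0; rewrite /es -esumD => [|x _|x _]; rewrite ?lee_fin //.
Qed.

Lemma es0 : es (fun=> 0) = 0%E.
Proof. by apply: esum1. Qed.

Lemma es_le_sum a (M : \bar R) :
  (forall r : seq I, uniq r -> ((\sum_(x <- r) a x)%:E <= M)%E) -> (es a <= M)%E.
Proof.
move=> h; apply: ge_ereal_sup => _ [X [finX _]] <-.
by rewrite fsbig_finite //= sumEFin; apply: h; exact: fset_uniq.
Qed.

Lemma sum_le_es a (r : seq I) : uniq r -> ((\sum_(x <- r) a x)%:E <= es a)%E.
Proof.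
move=> ur; apply: esum_ge; exists [set` r]%classic.
  by split=> //; exact: finite_seq.
by rewrite -fsbig_seq // sumEFin.
Qed.

Lemma esZ_le k a : 0 <= k -> (forall x, 0 <= a x) ->
  (es (fun x => k * a x)%R <= k%:E * es a)%E.
Proof.
move=> k0 a0; apply: es_le_sum => r ur; rewrite -mulr_sumr EFinM.
by apply: lee_wpmul2l; [rewrite lee_fin | exact: sum_le_es].
Qed.

Lemma es_sum (J : choiceType) (r : seq J) (a : J -> I -> R) :
  (forall j x, 0 <= a j x) ->
  es (fun x => \sum_(j <- r) a j x) = (\sum_(j <- r) es (a j))%E.
Proof.
move=> a0; rewrite /es -esum_sum => [|x j _ _]; last by rewrite lee_fin.
by apply: eq_esum => x _; rewrite sumEFin.
Qed.

Lemma es_bij (h : I -> I) a : bijective h -> es (a \o h) = es a.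
Proof.
move=> bh; rewrite /es [RHS](@reindex_esum _ _ _ [set: I]%classic [set: I]%classic h) //.
by rewrite setTT_bijective.
Qed.

Lemma es_supp (A : set I) (a : I -> R) : (forall x, ~ A x -> a x = 0) ->
  es a = (\esum_(x in A) (a x)%:E)%E.
Proof.
move=> h; rewrite esum_mkcond; apply: eq_esum => x _; case: ifP => // /negbT.
by rewrite notin_setE => /h ->.
Qed.

Definition fes a : R := fine (es a).

Lemma fesK a : (forall x, 0 <= a x) -> (es a < +oo)%E -> es a = (fes a)%:E.
Proof. by move=> a0 aoo; rewrite fineK // ge0_fin_numE // es_ge0. Qed.

Lemma fes_ge0 a : (forall x, 0 <= a x) -> 0 <= fes a.
Proof. by move=> a0; apply: fine_ge0; exact: es_ge0. Qed.

Lemma fesD a b : (forall x, 0 <= a x) -> (forall x, 0 <= b x) ->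
  (es a < +oo)%E -> (es b < +oo)%E -> fes (fun x => a x + b x) = fes a + fes b.
Proof.
move=> a0 b0 ha hb; rewrite /fes esD // fineD // ge0_fin_numE // es_ge0 //.
Qed.

Definition summ phi := (es (fun x => `|phi x|%R) < +oo)%E.

Definition ppart phi x := (`|phi x| + phi x) / 2.
Definition npart phi x := (`|phi x| - phi x) / 2.

Lemma ppart_ge0 phi x : 0 <= ppart phi x.
Proof. by rewrite /ppart; have := ler_norm (- phi x); rewrite normrN; lra. Qed.

Lemma npart_ge0 phi x : 0 <= npart phi x.
Proof. by rewrite /npart; have := ler_norm (phi x); lra. Qed.

Lemma pnpart phi x : ppart phi x + npart phi x = `|phi x|.
Proof. by rewrite /ppart /npart; lra. Qed.

Lemma ppartB phi x : phi x = ppart phi x - npart phi x.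
Proof. by rewrite /ppart /npart; lra. Qed.

Lemma summ_ppart phi : summ phi -> (es (ppart phi) < +oo)%E.
Proof.
apply: le_lt_trans; apply: le_es => x; rewrite -pnpart.
by have := npart_ge0 phi x; lra.
Qed.

Lemma summ_npart phi : summ phi -> (es (npart phi) < +oo)%E.
Proof.
apply: le_lt_trans; apply: le_es => x; rewrite -pnpart.
by have := ppart_ge0 phi x; lra.
Qed.

Definition tsum phi : R := fes (ppart phi) - fes (npart phi).

(** Any splitting computes the sum: [ppart phi + b = npart phi + a] is an identity between
    nonnegative functions. Linearity of [tsum] follows from this freedom. *)
Lemma tsum_diff phi a b : summ phi -> (forall x, 0 <= a x) ->
  (forall x, 0 <= b x) -> (es a < +oo)%E -> (es b < +oo)%E ->
  (forall x, phi x = a x - b x) -> tsum phi = fes a - fes b.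
Proof.
move=> sp a0 b0 ha hb e.
have h : fes (fun x => ppart phi x + b x) = fes (fun x => npart phi x + a x).
  by congr fine; apply: eq_es => x; have := e x; have := ppartB phi x; lra.
move: h; rewrite (fesD (ppart_ge0 phi) b0 (summ_ppart sp) hb).
by rewrite (fesD (npart_ge0 phi) a0 (summ_npart sp) ha) /tsum; lra.
Qed.

Lemma summD phi psi : summ phi -> summ psi -> summ (fun x => phi x + psi x).
Proof.
move=> h1 h2; apply: le_lt_trans (lte_add_pinfty h1 h2).
by rewrite -esD //; apply: le_es => x; exact: ler_normD.
Qed.

Lemma summN phi : summ phi -> summ (fun x => - phi x).
Proof. by apply: le_lt_trans; apply: le_es => x; rewrite normrN. Qed.

Lemma tsumD phi psi : summ phi -> summ psi ->
  tsum (fun x => phi x + psi x) = tsum phi + tsum psi.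
Proof.
move=> h1 h2; have p1 := ppart_ge0 phi; have p2 := ppart_ge0 psi.
have n1 := npart_ge0 phi; have n2 := npart_ge0 psi.
rewrite (@tsum_diff _ (fun x => ppart phi x + ppart psi x)
                      (fun x => npart phi x + npart psi x)).
- rewrite (fesD p1 p2 (summ_ppart h1) (summ_ppart h2)).
  by rewrite (fesD n1 n2 (summ_npart h1) (summ_npart h2)) /tsum; lra.
- exact: summD.
- by move=> x; apply: addr_ge0; exact: ppart_ge0.
- by move=> x; apply: addr_ge0; exact: npart_ge0.
- rewrite (esD p1 p2).
  by apply: lte_add_pinfty; exact: summ_ppart.
- rewrite (esD n1 n2).
  by apply: lte_add_pinfty; exact: summ_npart.
- by move=> x; have := ppartB phi x; have := ppartB psi x; lra.
Qed.

Lemma tsumN phi : summ phi -> tsum (fun x => - phi x) = - tsum phi.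
Proof.
move=> h; rewrite (@tsum_diff _ (npart phi) (ppart phi)).
- by rewrite /tsum; lra.
- exact: summN.
- exact: npart_ge0.
- exact: ppart_ge0.
- exact: summ_npart.
- exact: summ_ppart.
- by move=> x; have := ppartB phi x; lra.
Qed.

Lemma summ0 : summ (fun=> 0).
Proof. by rewrite /summ (@eq_es _ (fun=> 0)) ?es0 // => x; rewrite normr0. Qed.

Lemma tsum0 : tsum (fun=> 0) = 0.
Proof.
have := tsumD summ0 summ0; rewrite (_ : (fun _ : I => 0 + 0) = (fun=> 0)).
  by lra.
by apply/funext => x; rewrite addr0.
Qed.

Lemma summ_sign n phi : summ phi -> summ (fun x => (-1) ^+ n * phi x).
Proof.
apply: le_lt_trans; apply: le_es => x.
by rewrite normrM normrX normrN1 expr1n mul1r.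
Qed.

Lemma tsum_sign n phi : summ phi ->
  tsum (fun x => (-1) ^+ n * phi x) = (-1) ^+ n * tsum phi.
Proof.
move=> h; rewrite -signr_odd; case: (odd n); rewrite ?expr1 ?expr0.
  rewrite mulN1r -tsumN //; congr tsum; apply/funext => x.
  by rewrite mulN1r.
by rewrite mul1r; congr tsum; apply/funext => x; rewrite mul1r.
Qed.

Lemma tsum_sum (J : Type) (r : seq J) (P : pred J) (phi : J -> I -> R) :
  (forall j, summ (phi j)) ->
  tsum (fun x => \sum_(j <- r | P j) phi j x) = \sum_(j <- r | P j) tsum (phi j).
Proof.
move=> h; suff [] : summ (fun x => \sum_(j <- r | P j) phi j x) /\
  tsum (fun x => \sum_(j <- r | P j) phi j x) = \sum_(j <- r | P j) tsum (phi j) by [].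
elim: r => [|j r [IH1 IH2]].
  rewrite big_nil (_ : (fun x => _) = (fun=> 0)); last first.
    by apply/funext => x; rewrite big_nil.
  by split; [exact: summ0 | exact: tsum0].
rewrite big_cons; case: ifP => Pj; last first.
  rewrite (_ : (fun x => _) = (fun x => \sum_(j <- r | P j) phi j x)) //.
  by apply/funext => x; rewrite big_cons Pj.
rewrite (_ : (fun x => _) = (fun x => phi j x + \sum_(j <- r | P j) phi j x)).
  by split; [exact: summD | rewrite tsumD // IH2].
by apply/funext => x; rewrite big_cons Pj.
Qed.

Lemma tsum_bij (h : I -> I) phi : bijective h -> tsum (phi \o h) = tsum phi.
Proof.
by move=> bh; rewrite /tsum /fes -(es_bij (ppart phi) bh) -(es_bij (npart phi) bh).
Qed.

Lemma tsum_anti (h : I -> I) phi : bijective h -> summ phi ->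
  (forall x, phi (h x) = - phi x) -> tsum phi = 0.
Proof.
move=> bh sp e; have := tsum_bij phi bh.
rewrite (_ : phi \o h = (fun x => - phi x)); last by apply/funext => x; rewrite /= e.
by rewrite tsumN //; lra.
Qed.

Lemma norm_tsum phi : summ phi -> `|tsum phi| <= fes (fun x => `|phi x|).
Proof.
move=> h; have p0 := ppart_ge0 phi; have n0 := npart_ge0 phi.
have hp := summ_ppart h; have hn := summ_npart h.
have -> : fes (fun x => `|phi x|) = fes (ppart phi) + fes (npart phi).
  by rewrite -fesD //; congr fine; apply: eq_es => x; rewrite pnpart.
rewrite /tsum; have := fes_ge0 p0; have := fes_ge0 n0.
by rewrite ler_norml; lra.
Qed.

Lemma tsum_single phi y : (forall x, x != y -> phi x = 0) -> tsum phi = phi y.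
Proof.
move=> h; have esy a : (forall x, x != y -> a x = 0) -> 0 <= a y -> fes a = a y.
  move=> ay a0; rewrite /fes (@es_supp [set y]%classic) => [|x /eqP]; last exact: ay.
  by rewrite esum_set1.
have e1 : fes (ppart phi) = ppart phi y.
  apply: esy => [x /h e|]; last exact: ppart_ge0.
  by rewrite /ppart e normr0; lra.
have e2 : fes (npart phi) = npart phi y.
  apply: esy => [x /h e|]; last exact: npart_ge0.
  by rewrite /npart e normr0; lra.
by rewrite /tsum e1 e2 -ppartB.
Qed.

(* Cauchy-Schwarz, from the arithmetic-geometric mean inequality
   [2 |phi| <= l a + b / l] with the optimal [l]. *)
Lemma es_cauchy phi a b (A B : R) : (forall x, 0 <= a x) -> (forall x, 0 <= b x) ->
  (forall x, phi x ^+ 2 <= a x * b x) -> (es a <= A%:E)%E -> (es b <= B%:E)%E ->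
  summ phi /\ tsum phi ^+ 2 <= A * B.
Proof.
move=> a0 b0 ab hA hB.
have A0 : 0 <= A by rewrite -lee_fin; apply: le_trans hA; exact: es_ge0.
have B0 : 0 <= B by rewrite -lee_fin; apply: le_trans hB; exact: es_ge0.
have bound l : 0 < l ->
    (es (fun x => `|phi x|%R) <= ((l * A + l^-1 * B) / 2)%:E)%E.
  move=> l0; have l2 : 0 <= l / 2 by lra.
  have l3 : 0 <= l^-1 / 2 by rewrite divr_ge0 // invr_ge0 ltW.
  apply: (@le_trans _ _ (es (fun x => l / 2 * a x + l^-1 / 2 * b x))).
    apply: le_es => x; have lb : 0 <= l^-1 * b x by rewrite mulr_ge0 // invr_ge0 ltW.
    have la : 0 <= l * a x by rewrite mulr_ge0 // ltW.
    have : `|phi x| ^+ 2 <= (l * a x) * (l^-1 * b x).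
      rewrite real_normK ?num_real //; apply: le_trans (ab x) _.
      by rewrite mulrACA divff ?mul1r // gt_eqF.
    rewrite [l / 2 * _]mulrAC [l^-1 / 2 * _]mulrAC -mulrDl.
    move: (l * a x) (l^-1 * b x) la lb => u v u0 v0 huv.
    rewrite ler_pdivlMr // -ler_sqr ?nnegrE ?addr_ge0 ?mulr_ge0 //.
    have := sqr_ge0 (u - v); nra.
  rewrite esD => [|x|x]; try exact: mulr_ge0.
  have -> : (l * A + l^-1 * B) / 2 = l / 2 * A + l^-1 / 2 * B by lra.
  rewrite EFinD; apply: leeD.
    apply: le_trans (esZ_le l2 a0) _; rewrite (EFinM _ A).
    by apply: lee_wpmul2l; rewrite ?lee_fin.
  apply: le_trans (esZ_le l3 b0) _; rewrite (EFinM _ B).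
  by apply: lee_wpmul2l; rewrite ?lee_fin.
have sp : summ phi by apply: le_lt_trans (bound 1 ltr01) _; rewrite ltry.
split=> //; have := norm_tsum sp; set N := fes _ => hN.
have N0 : 0 <= N by apply: fes_ge0.
have {}bound l : 0 < l -> N <= (l * A + l^-1 * B) / 2.
  by move=> /bound; rewrite (fesK _ sp) // lee_fin.
suff : N ^+ 2 <= A * B.
  by apply: le_trans; rewrite -(real_normK (num_real _)) ler_sqr ?nnegrE.
move: N0; rewrite le_eqVlt => /orP[/eqP <-|N0]; first by rewrite expr0n mulr_ge0.
move: A0; rewrite le_eqVlt => /orP[/eqP Az|Ap].
  have [Bz|Bp] := eqVneq B 0.
    by have := bound 1 ltr01; rewrite -Az Bz; lra.
  have {}Bp : 0 < B by rewrite lt_neqAle eq_sym Bp.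
  (* For [A = 0] this choice of [l] turns the bound into [N <= N / 2]. *)
  have := bound (B / N) (divr_gt0 Bp N0); rewrite -Az mulr0 add0r invf_div.
  by rewrite divfK ?gt_eqF //; lra.
(* The optimal [l]: the bound becomes [N <= (N + A * B / N) / 2]. *)
have := bound (N / A) (divr_gt0 N0 Ap); rewrite divfK ?gt_eqF // invf_div.
have -> : A / N * B = A * B / N by rewrite mulrAC.
move=> h; have : N <= A * B / N by lra.
by rewrite ler_pdivlMr // -expr2.
Qed.

End AbsoluteSums.

(** * Weights of group elements *)

Section Weights.
Variables (R : realType) (S : finType) (m : S -> S -> nat).
Variables (mP : coxeter_matrix m) (q : S -> R).
Local Notation G := (coxgroup mP).
Local Notation wd := (wd mP).
Local Notation gen := (gen mP).
Local Notation rl := (rl mP).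
Implicit Types (x y z t : G) (s : S) (U V : {set S}) (w : seq S).
Hypothesis q_gt0 : forall s, (0 < q s)%R.
Hypothesis q_conj : forall s s' w, coxeq m (w ++ s :: rev w) [:: s'] -> q s = q s'.
Local Open Scope group_scope.

Lemma q_conjg s s' x : gen s ^ x = gen s' -> q s = q s'.
Proof.
move=> e; apply: (@q_conj s s' (word x^-1)); apply/(wdE mP).
by rewrite wd_cat wd_cons wd_rev wordK invgK -/(gen s') -e conjgE.
Qed.

(** Conjugate generators have equal weights, so the weight of a reflection is well defined; other
    elements get the default 0. *)
Definition qrefl t : R :=
  xget 0%R [set a | exists x s, t = gen s ^ x /\ a = q s]%classic.

Lemma qreflE s x : qrefl (gen s ^ x) = q s.
Proof.
rewrite /qrefl; have [|y [s' [e ->]]] := @xgetPex _ 0%R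
    [set a | exists y s', gen s ^ x = gen s' ^ y /\ a = q s']%classic.
  by exists (q s), x, s.
by apply: (@q_conjg _ _ (y * x^-1)); rewrite conjgM -e conjgK.
Qed.

Lemma qreflJ t x : refl t -> qrefl (t ^ x) = qrefl t.
Proof. by case=> y [s ->]; rewrite -conjgM !qreflE. Qed.

(** For a reduced word the reflections are the inversions of the element, so its weight does not
    depend on the chosen reduced word. *)
Lemma prod_rl w : (\prod_(t <- rl w) qrefl t = qw q w)%R.
Proof.
elim: w => [|s w IH]; first by rewrite /qw !big_nil.
rewrite /qw !big_cons -[gen s in LHS](conjg1) qreflE -/(qw q w) -IH big_map.
by congr (_ * _)%R; apply: eq_big_seq => t /rl_refl; exact: qreflJ.
Qed.

Definition qG x : R := qw q (rword x).

Lemma qG_red w : red mP w -> qw q w = qG (wd w).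
Proof.
move=> rw; rewrite /qG -!prod_rl; apply: perm_big; apply: uniq_perm.
- exact: uniq_rl.
- exact/uniq_rl/red_rword.
- by move=> t; rewrite -inv_red // inv_rword.
Qed.

Lemma qw_gt0 w : (0 < qw q w)%R.
Proof. exact: prodr_gt0. Qed.

Lemma qG_gt0 x : (0 < qG x)%R.
Proof. exact: qw_gt0. Qed.

Lemma qG_sub x y : (forall t, inv y t -> inv x t) ->
  qG x = (qG y * qG (y^-1 * x)%g)%R.
Proof.
move=> /inv_sub_perm h; rewrite /qG -!prod_rl (perm_big _ h) /= big_cat big_map.
by congr (_ * _)%R; apply: eq_big_seq => t /rl_refl; exact: qreflJ.
Qed.

Lemma qG_mul x y : len (x * y) = len x + len y -> qG (x * y)%g = (qG x * qG y)%R.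
Proof.
by move=> h; rewrite (@qG_sub _ x) ?mulKg // => t; exact: inv_mul_sub.
Qed.

Lemma qG_canon U c z : canon m U c -> inP U z ->
  qG (wd c * z)%g = (qG (wd c) * qG z)%R.
Proof. by move=> hc Uz; apply: qG_mul; exact: (len_canon hc Uz). Qed.

Lemma region_esum V :
  esum [set w | canon m (finset.set0 : {set S}) w /\ inW m V w]%classic
    (fun w => (qw q w)%:E) =
  esum [set x | inP V x]%classic (fun x => (qG x)%:E).
Proof.
rewrite [RHS](@reindex_esum _ _ _
  [set w | canon m finset.set0 w /\ inW m V w]%classic _ wd).
  by apply: eq_esum => w [cw _]; rewrite qG_red //; exact: canon_red cw.
split.
- by move=> w [_ /(inWE mP)].
- move=> w w' /set_mem[cw _] /set_mem[cw' _] e.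
  by rewrite -(cword_wd mP cw) -(cword_wd mP cw') e.
- move=> x /= Vx; exists (cword x); last exact: cwordK.
  by split; [exact: cword_canon | apply/(inWE mP); rewrite cwordK].
Qed.

End Weights.

(** * The signed push-forward along the folding map *)

Section Push.
Variables (R : realType) (S : finType) (m : S -> S -> nat).
Variables (mP : coxeter_matrix m) (q : S -> R) (V : {set S}) (A : R).
Local Notation G := (coxgroup mP).
Local Notation gen := (gen mP).
Local Notation wd := (wd mP).
Local Notation qG := (@qG R S m mP q).
Implicit Types (x y z t : G) (s : S) (c : G -> R).
Hypothesis q_gt0 : forall s, (0 < q s)%R.
Hypothesis q_conj : forall s s' w, coxeq m (w ++ s :: rev w) [:: s'] -> q s = q s'.
Hypothesis A_ge0 : (0 <= A)%R.
Hypothesis AE : esum [set x | inP V x]%classic (fun x => (qG x)%:E) = A%:E.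
Let qpos := @qG_gt0 R S m mP q q_gt0.

Local Open Scope group_scope.

(** Only the [W_V]-component of [x] is folded, so that every coset of [W_V] is preserved. *)
Definition cfold n x : G := rep V x * fold n ((rep V x)^-1 * x).

Lemma cfold_inP n x : inP V ((cfold n x)^-1 * x).
Proof.
rewrite invgM -mulgA; apply: inPM; last exact: rep_inPV.
exact/inPV/fold_inP/rep_inPV.
Qed.

Lemma rep_cfold n x : rep V (cfold n x) = rep V x.
Proof. by congr wd; apply: crp_coset; exact: cfold_inP. Qed.

Lemma rep_mulgen x s : s \in V -> rep V (x * gen s) = rep V x.
Proof. by move=> Vs; rewrite /rep crp_mulgen. Qed.

Lemma cfold_mulgen n x s : s \in V ->
  cfold n (x * gen s) = cfold n x \/ cfold n (x * gen s) = cfold n x * gen s.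
Proof.
move=> Vs; rewrite /cfold rep_mulgen // mulgA.
case: (fold_mulgen n ((rep V x)^-1 * x) s) => ->; first by left.
by right; rewrite mulgA.
Qed.

(** The folded component is a prefix of the original one, and the weight of the shortest
    representative factors out of both. *)
Lemma cfold_qG n x : qG x = (qG (cfold n x) * qG ((cfold n x)^-1 * x)%g)%R.
Proof.
set p := rep V x; set v := p^-1 * x; set y := fold n v.
have Vv : inP V v by exact: rep_inPV.
have Vy : inP V y by exact: fold_inP.
have qp z : inP V z -> qG (p * z)%g = (qG p * qG z)%R.
  by apply: qG_canon => //; exact: crp_canon.
have xE : x = p * v by rewrite /v mulVKg.
have cE : cfold n x = p * y by [].
have -> : (cfold n x)^-1 * x = y^-1 * v by rewrite cE invgM -mulgA.
rewrite cE {1}xE !qp // -mulrA -qG_sub // => t; exact: fold_inv.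
Qed.

Lemma cfold_id n x : (len x).*2 <= n -> cfold n x = x.
Proof.
move=> h; rewrite /cfold fold_small ?mulVKg //; apply: small_le.
apply: leq_trans h; rewrite leq_double; have := len_rep V x; lia.
Qed.

Lemma cfold_len n x : len (cfold n x) <= len (rep V x) + size (ball mP n).
Proof.
apply: leq_trans (lenM _ _) _; rewrite leq_add2l.
exact/small_len/small_fold.
Qed.

Local Open Scope ring_scope.

Definition nrm c : \bar R := es (fun x => c x ^+ 2 / qG x).

Definition sg x : R := (-1) ^+ sgn x.

Lemma sg_gen x s : sg (x * gen s)%g = - sg x.
Proof. by rewrite /sg sgnM sgn_gen addbT; case: (sgn x); rewrite ?opprK. Qed.

Lemma sg_sq x : sg x * sg x = 1.
Proof. by rewrite -expr2 sqrr_sign. Qed.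

Definition fiber n c y x : R := if cfold n x == y then sg x * sg y * c x else 0.

(** Folding bounds only the [W_V]-component. The cutoff leaves finitely many cosets of [W_V] and,
    being constant on each, respects right [W_V]-invariance. *)
Definition push n c y : R :=
  if (len (rep V y) <= n)%N then tsum (fiber n c y) else 0.

Definition fenergy n c y x : R := if cfold n x == y then c x ^+ 2 / qG x else 0.

Lemma sq_div_ge0 c x : 0 <= c x ^+ 2 / qG x.
Proof. by rewrite divr_ge0 ?sqr_ge0 ?ltW. Qed.

Lemma fenergy_ge0 n c y x : 0 <= fenergy n c y x.
Proof. by rewrite /fenergy; case: ifP => // _; exact: sq_div_ge0. Qed.

Lemma fenergy_le n c y : (es (fenergy n c y) <= nrm c)%E.
Proof.
by apply: le_es => x; rewrite /fenergy; case: ifP => // _; exact: sq_div_ge0.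
Qed.

(** The fibre lies in [y W_V] and its weights factor through [qG y]; a left translation by [y]
    reduces the sum to the growth series of [W_V]. *)
Lemma fiber_mass n y :
  (es (fun x => if cfold n x == y then qG x else 0%R) <= (qG y * A)%:E)%E.
Proof.
apply: (@le_trans _ _ (es (fun x => if `[< inP V (y^-1 * x)%g >] then
    qG y * qG (y^-1 * x)%g else 0))).
  apply: le_es => x; case: eqP => [<-|_].
    by rewrite asboolT -?cfold_qG //; exact: cfold_inP.
  by case: ifP => // _; rewrite mulr_ge0 ?ltW.
have bij : bijective (fun x => y * x)%g.
  by exists (fun x => y^-1 * x)%g => x; rewrite ?mulKg ?mulVKg.
rewrite -(es_bij _ bij).
rewrite (@eq_es _ _ _ (fun x => qG y * (if `[< inP V x >] then qG x else 0))); last first.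
  by move=> x /=; rewrite mulKg; case: ifP; rewrite ?mulr0.
have q0 : 0 <= qG y by exact: ltW.
apply: le_trans (esZ_le q0 _) _.
  by move=> x; case: ifP => // _; exact: ltW.
rewrite (EFinM (qG y) A); apply: lee_wpmul2l; first by rewrite lee_fin.
rewrite -AE (@es_supp _ _ [set x | inP V x]%classic).
  by apply: le_esum => x /= Vx; rewrite asboolT.
by move=> x /= Vx; rewrite asboolF.
Qed.

Lemma fiber_cauchy n c y : (nrm c < +oo)%E -> summ (fiber n c y) /\
  tsum (fiber n c y) ^+ 2 <= fes (fenergy n c y) * (qG y * A).
Proof.
move=> hc; apply: (@es_cauchy _ _ _ (fenergy n c y)
  (fun x => if cfold n x == y then qG x else 0)).
- exact: fenergy_ge0.
- by move=> x; case: ifP => // _; exact: ltW.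
- move=> x; rewrite /fiber /fenergy; case: ifP => _; last by rewrite mulr0 expr0n.
  rewrite divfK ?gt_eqF // !exprMn; have := sg_sq x; have := sg_sq y.
  by rewrite -!expr2 => -> ->; rewrite !mul1r.
- rewrite -fesK //; first exact: fenergy_ge0.
  exact: le_lt_trans (fenergy_le n c y) hc.
- exact: fiber_mass.
Qed.

(** Cauchy-Schwarz on the fibre over [y] cancels the weight [qG y], leaving [A] times the energy of
    the fibre; the fibres are disjoint. *)
Lemma nrm_push n c : (nrm c < +oo)%E -> (nrm (push n c) <= A%:E * nrm c)%E.
Proof.
move=> hc; apply: es_le_sum => r ur.
apply: (@le_trans _ _ (\sum_(y <- r) (A * fes (fenergy n c y)))%:E).
  rewrite lee_fin; apply: ler_sum => y _; rewrite /push; case: ifP => _.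
    rewrite ler_pdivrMr //; apply: le_trans (fiber_cauchy n y hc).2 _.
    by rewrite mulrA mulrAC [A * _]mulrC.
  rewrite expr0n mul0r mulr_ge0 // fes_ge0 //; exact: fenergy_ge0.
rewrite -mulr_sumr EFinM; apply: lee_wpmul2l; first by rewrite lee_fin.
rewrite -sumEFin (eq_bigr (fun y => es (fenergy n c y))); last first.
  move=> y _; rewrite -fesK //; first exact: fenergy_ge0.
  exact: le_lt_trans (fenergy_le n c y) hc.
rewrite -es_sum; last by move=> y x; exact: fenergy_ge0.
apply: le_es => x; rewrite /fenergy -big_mkcond /=.
have [xr|xr] := boolP (cfold n x \in r); last first.
  rewrite big_seq_cond big1 ?sq_div_ge0 // => y /andP[yr /eqP e].
  by rewrite e yr in xr.
rewrite (eq_bigl (pred1 (cfold n x))) => [|y]; last by rewrite /= eq_sym.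
by rewrite -big_filter filter_pred1_uniq // big_seq1.
Qed.

Lemma pushD n c c' y : (nrm c < +oo)%E -> (nrm c' < +oo)%E ->
  push n (fun x => c x + c' x) y = push n c y + push n c' y.
Proof.
move=> hc hc'; rewrite /push; case: ifP => _; last by rewrite addr0.
rewrite -tsumD; first last.
- by have [] := fiber_cauchy n y hc'.
- by have [] := fiber_cauchy n y hc.
congr tsum; apply/funext => x; rewrite /fiber; case: ifP => _; last by rewrite addr0.
by rewrite mulrDr.
Qed.

Lemma push0 n c y : (forall x, c x = 0) -> push n c y = 0.
Proof.
move=> h; rewrite /push; case: ifP => // _; rewrite -[RHS](tsum0 R G).
by congr tsum; apply/funext => x; rewrite /fiber h mulr0; case: ifP.
Qed.

Lemma push_sum n (J : finType) (P : pred J) (k : J -> nat) (c : J -> G -> R) y :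
  (forall j, (nrm (c j) < +oo)%E) ->
  (forall x, \sum_(j | P j) (-1) ^+ k j * c j x = 0) ->
  \sum_(j | P j) (-1) ^+ k j * push n (c j) y = 0.
Proof.
move=> hc h; have [ln|ln] := boolP (len (rep V y) <= n)%N; last first.
  by rewrite big1 // => j _; rewrite /push (negbTE ln) mulr0.
rewrite /push ln.
have sf j : summ (fiber n (c j) y) by have [] := fiber_cauchy n y (hc j).
rewrite (eq_bigr (fun j => tsum (fun x => (-1) ^+ k j * fiber n (c j) y x))).
  rewrite -tsum_sum => [|j]; last exact: summ_sign.
  rewrite -[RHS](tsum0 R G); congr tsum; apply/funext => x.
  have [e|e] := eqVneq (cfold n x) y; last first.
    by rewrite big1 // => j _; rewrite /fiber (negbTE e) mulr0.
  rewrite (eq_bigr (fun j => sg x * sg y * ((-1) ^+ k j * c j x))).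
    by rewrite -mulr_sumr h mulr0.
  by move=> j _; rewrite /fiber e eqxx mulrCA.
by move=> j _; rewrite tsum_sign.
Qed.

(** Pair [x] with [x * gen s]. If their folds differ by [gen s], the contributions to the two sides
    agree; if the folds coincide, the opposite signs make the pair cancel. In both cases the
    difference of the summands is antisymmetric under the pairing. *)
Lemma push_mulgen n c y s : s \in V -> (nrm c < +oo)%E ->
  (forall x, c (x * gen s)%g = c x) -> push n c (y * gen s)%g = push n c y.
Proof.
move=> Vs hc ci; rewrite /push rep_mulgen //; case: ifP => // _.
have bij : bijective (fun x => x * gen s)%g.
  by exists (fun x => x * gen s)%g => x; rewrite genK.
have [s1 _] := fiber_cauchy n (y * gen s)%g hc.
have [s2 _] := fiber_cauchy n y hc.
have s1' : summ (fiber n c (y * gen s)%g \o (fun x => x * gen s)%g).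
  by rewrite /summ (@es_bij _ _ _ (fun x => `|fiber n c (y * gen s)%g x|)).
apply/eqP; rewrite -subr_eq0 -(tsum_bij _ bij) -tsumN // -tsumD //; last exact: summN.
apply/eqP/(tsum_anti bij) => [|x]; first by apply: summD => //; exact: summN.
have eqg u v : (u * gen s == v * gen s)%g = (u == v).
  by apply/eqP/eqP => [/mulIg|->].
rewrite /fiber /= genK !sg_gen !ci; have [->|->] := cfold_mulgen n x Vs.
  by case: (cfold n x == y); case: (cfold n x == _); ring.
have -> : (cfold n x == y * gen s)%g = (cfold n x * gen s == y)%g.
  by rewrite -(eqg _ y) genK.
by rewrite eqg; case: (cfold n x == y); case: (_ == y); ring.
Qed.

Lemma push_len n c y : push n c y != 0 -> (len y <= n + size (ball mP n))%N.
Proof.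
rewrite /push; case: ifP => [ln|_]; last by rewrite eqxx.
have [[x e] _|h] := pselect (exists x, cfold n x = y).
  rewrite -e in ln *; rewrite rep_cfold in ln; apply: leq_trans (cfold_len n x) _.
  by rewrite leq_add2r.
rewrite (_ : fiber n c y = (fun=> 0)) ?tsum0 ?eqxx //.
by apply/funext => x; rewrite /fiber; case: eqP => // e; case: h; exists x.
Qed.

(** Inversions of [x] have length below twice [len x], so elements of length at most [k] are fixed
    by the fold. *)
Lemma push_id n k c y : (k.*2 <= n)%N -> (forall x, (k < len x)%N -> c x = 0) ->
  push n c y = c y.
Proof.
move=> kn ck.
have fE x : x != y -> fiber n c y x = 0.
  move=> xy; rewrite /fiber; case: eqP => // e.
  have [lx|/ck ->] := leqP (len x) k; last by rewrite mulr0.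
  by case/eqP: xy; rewrite -e cfold_id //; lia.
have [ly|ly] := leqP (len y) k; last first.
  rewrite ck // /push; case: ifP => // _; rewrite (tsum_single fE) /fiber.
  by case: ifP => // _; rewrite ck // mulr0.
rewrite /push ifT; last by have := len_rep V y; lia.
by rewrite (tsum_single fE) /fiber cfold_id ?eqxx ?sg_sq ?mul1r //; lia.
Qed.

(** Split [c] into a part [c0] on a ball, fixed by [push] for large [n], and a remainder [c1] of
    small norm, which [push] keeps small uniformly in [n]. *)
Lemma push_cvg c (e : R) : (nrm c < +oo)%E -> 0 < e ->
  exists N, forall n, (N <= n)%N -> (nrm (fun x => (push n c x - c x)%R) < e%:E)%E.
Proof.
(* The error is at most [2 * (A + 1)] times the squared norm of [c1], which is below [d]. *)
move=> hc e0; pose d := e / (2 * (A + 2)).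
have A2 : 0 < 2 * (A + 2) by have := A_ge0; lra.
have d0 : 0 < d by rewrite divr_gt0.
have fn : nrm c \is a fin_num.
  by rewrite ge0_fin_numE //; apply: es_ge0 => x; exact: sq_div_ge0.
have [_ [X [finX _] <-]] := ub_ereal_sup_adherent d0 fn.
rewrite -/(nrm c) fsbig_finite //= sumEFin; set F := fset_set X => hX.
pose k := \max_(x <- F) len x.
pose c0 x := if (len x <= k)%N then c x else 0.
pose c1 x := if (len x <= k)%N then 0 else c x.
have nE : nrm c = (nrm c0 + nrm c1)%E.
  rewrite /nrm -esD => [|x|x]; try exact: sq_div_ge0.
  apply: eq_es => x; rewrite /c0 /c1; case: ifP => _.
    by rewrite expr0n mul0r addr0.
  by rewrite expr0n mul0r add0r.
have n0 : (nrm c - d%:E < nrm c0)%E.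
  apply: lt_le_trans hX _.
  apply: le_trans (sum_le_es (fun x => c0 x ^+ 2 / qG x) (fset_uniq F)).
  rewrite lee_fin le_eqVlt; apply/orP; left; apply/eqP/eq_big_seq => x xF.
  rewrite /c0 ifT // /k; exact: (@leq_bigmax_seq _ _ _ _ x).
have n0oo : (nrm c0 < +oo)%E.
  apply: le_lt_trans hc; rewrite nE leeDl // es_ge0 // => x; exact: sq_div_ge0.
have n1oo : (nrm c1 < +oo)%E.
  apply: le_lt_trans hc; rewrite nE leeDr // es_ge0 // => x; exact: sq_div_ge0.
have n1 : (nrm c1 < d%:E)%E.
  move: n0; rewrite nE; have g0 := fesK (sq_div_ge0 c0) n0oo.
  have g1 := fesK (sq_div_ge0 c1) n1oo; rewrite -/(nrm c0) in g0.
  rewrite -/(nrm c1) in g1; rewrite g0 g1 /= !lte_fin; lra.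
exists k.*2 => n kn.
have cxE x : c x = c0 x + c1 x.
  by rewrite /c0 /c1; case: ifP => _; rewrite ?addr0 ?add0r.
have cE : c = (fun x => c0 x + c1 x) by apply/funext.
have pE x : push n c x - c x = push n c1 x - c1 x.
  rewrite [in push n c x]cE pushD // (@push_id n k c0) //; last first.
    by move=> y ly; rewrite /c0 leqNgt ly.
  by rewrite cxE; lra.
have -> : nrm (fun x => push n c x - c x)%R = nrm (fun x => push n c1 x - c1 x)%R.
  by apply: eq_es => x; rewrite pE.
apply: (@le_lt_trans _ _ (es (fun x => 2 * (push n c1 x ^+ 2 / qG x) +
                                       2 * (c1 x ^+ 2 / qG x)))).
  apply: le_es => x; rewrite !mulrA -mulrDl.
  apply: ler_wpM2r; first by rewrite invr_ge0 ltW.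
  rewrite -subr_ge0 [X in 0 <= X](_ : _ = (push n c1 x + c1 x) ^+ 2) ?sqr_ge0 //.
  by ring.
have two0 : 0 <= 2 :> R by lra.
rewrite esD => [|x|x]; try (by apply: mulr_ge0 => //; exact: sq_div_ge0).
apply: (@le_lt_trans _ _ (2%:E * (A%:E * nrm c1) + 2%:E * nrm c1)%E).
  apply: leeD; apply: le_trans (esZ_le two0 _) _; try exact: sq_div_ge0.
    by apply: lee_wpmul2l; rewrite ?lee_fin //; exact: nrm_push.
  by [].
have g1 := fesK (sq_div_ge0 c1) n1oo; rewrite -/(nrm c1) in g1.
move: n1; rewrite g1 -!EFinM -EFinD !lte_fin => n1.
have f0 : 0 <= fes (fun x => c1 x ^+ 2 / qG x) by apply: fes_ge0; exact: sq_div_ge0.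
move: n1 f0; set z := fes _ => n1 f0.
have -> : e = 2 * (A + 2) * d by rewrite /d mulrC divfK // gt_eqF.
apply: (@le_lt_trans _ _ (2 * (A + 2) * z)); last by rewrite ltr_pM2l.
by nra.
Qed.

End Push.

(** * From chains on cells to functions on the group *)

Lemma esum_subset (R : realType) (I : choiceType) (A B : set I) (a : I -> \bar R) :
  (A `<=` B)%classic -> (forall x, (0 <= a x)%E) -> (esum A a <= esum B a)%E.
Proof.
move=> AB a0; rewrite esum_mkcond [leRHS]esum_mkcond; apply: le_esum => x _.
case: ifP => [/set_mem/AB/mem_set -> //|_]; by case: ifP.
Qed.

Section Cells.
Variables (R : realType) (S : finType) (m : S -> S -> nat).
Variables (mP : coxeter_matrix m) (q : S -> R) (T : {set S}).
Local Notation G := (coxgroup mP).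
Local Notation wd := (wd mP).
Local Notation gen := (gen mP).
Local Notation qG := (@qG R S m mP q).
Local Notation nrm := (@nrm R S m mP q).
Implicit Types (x y z : G) (s : S) (U V : {set S}) (w : seq S).
Hypothesis q_gt0 : forall s, (0 < q s)%R.
Hypothesis q_conj : forall s s' w, coxeq m (w ++ s :: rev w) [:: s'] -> q s = q s'.
Local Open Scope ring_scope.

Let qpos := @qG_gt0 R S m mP q q_gt0.
Let qwpos := @qw_gt0 R S q q_gt0.

Lemma inv_inP U (c : G -> R) x z : (forall s y, s \in U -> c (y * gen s)%g = c y) ->
  inP U z -> c (x * z)%g = c x.
Proof.
move=> h [w [Uw <-]]; elim: w x Uw => [|s w IH] x /=; first by rewrite wd0 mulg1.
by move=> /andP[Us Uw]; rewrite wd_cons mulgA IH // h.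
Qed.

(* A chain becomes a right [W_U]-invariant function on the group, and the
   weighted boundary becomes the alternating sum of inclusions [bd]. *)
Definition lift (f : {set S} -> seq S -> R) U x : R :=
  (-1) ^+ size (crp U x) * qw q (crp U x) * f U (crp U x).

Lemma lift_mulgen f U s x : s \in U -> lift f U (x * gen s)%g = lift f U x.
Proof. by move=> Us; rewrite /lift crp_mulgen. Qed.

Lemma dq_lift f U w : canon m U w -> dq m q f U w =
  (qw q w)^-1 * ((-1) ^+ size w *
  \sum_(s | (s \notin U) && `[< spherical m (s |: U) >])
    eps R s (s |: U) * lift f (s |: U) (wd w)).
Proof.
move=> cw; rewrite /dq; congr (_ * _); rewrite mulr_sumr; apply: eq_bigr => s _.
rewrite /lift crp_wd; set a := crep m (s |: U) w.
have aw : (size a <= size w)%N.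
  have [ca wa] := crepP mP (s |: U) w.
  by apply/shortlex_size/ca/(in_coset_sym mP).
have -> : (-1) ^+ (size w - size a) = (-1) ^+ size w * (-1) ^+ size a :> R.
  by rewrite -[in RHS](subnK aw) exprD -mulrA -expr2 sqrr_sign mulr1.
by ring.
Qed.

(** Cells of a fixed type correspond injectively to the shortest elements of their cosets, so the
    sum over cells is part of the sum over the group. *)
Lemma wnorm2_le j (h : {set S} -> seq S -> R) (d : {set S} -> G -> R) :
  (forall U w, relcell m T j (U, w) ->
     h U w ^+ 2 * qw q w = d U (wd w) ^+ 2 / qG (wd w)) ->
  (wnorm2 m q T j h <= \sum_(U : {set S}) nrm (d U))%E.
Proof.
move=> hd; pose F (c : {set S} * seq S) : \bar R := (h c.1 c.2 ^+ 2 * qw q c.2)%:E.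
have F0 c : (0 <= F c)%E by rewrite lee_fin mulr_ge0 ?sqr_ge0 // ltW.
have -> : wnorm2 m q T j h =
    esum (relcell m T j) (fun c => (\sum_(U <- index_enum {set S})
      (if c \in [set c | c.1 = U]%classic then F c else 0))%E).
  apply: eq_esum => c _; rewrite -/(F c) -big_mkcond /=.
  rewrite (eq_bigl (pred1 c.1)) ?big_pred1_eq // => U.
  by apply/idP/eqP => [/set_mem /= <- //|->]; exact/mem_set.
rewrite esum_sum => [|c U _ _]; last by case: ifP.
apply: lee_sum => U _; rewrite -esum_mkcondr.
pose X := (relcell m T j `&` [set c | c.1 = U])%classic.
have injX : set_inj X (fun c => wd c.2).
  move=> [U1 w1] [U2 w2] /set_mem[[/= _ _ _ c1] e1] /set_mem[[/= _ _ _ c2] e2] e.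
  rewrite /= in e1 e2 e *; subst U1 U2; congr pair.
  by rewrite -(canon_crp mP c1) -(canon_crp mP c2) e.
rewrite (@eq_esum _ _ _ _ (fun c => (d U (wd c.2) ^+ 2 / qG (wd c.2))%:E)).
  rewrite -(@esum_image _ _ _ X (fun c => wd c.2) (fun x => (d U x ^+ 2 / qG x)%:E)) //.
  by apply: esum_subset => // x; rewrite lee_fin divr_ge0 ?sqr_ge0 // ltW.
by move=> [U1 w] [hw /= e]; subst U1; rewrite /F hd.
Qed.

Lemma nrm_finite (c : G -> R) L : (forall x, (L <= len x)%N -> c x = 0) ->
  (nrm c < +oo)%E.
Proof.
move=> h; rewrite /nrm (@es_supp _ _ [set` ball mP L]%classic); last first.
  move=> x /= nx; rewrite h ?expr0n ?mul0r // leqNgt.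
  by apply/negP => lx; apply: nx; apply: ballP; exact: ltnW.
rewrite esum_fset; first last.
- by move=> x _; rewrite lee_fin divr_ge0 ?sqr_ge0 // ltW.
- exact: finite_seq.
by rewrite fsumEFin ?ltry //; exact: finite_seq.
Qed.

Lemma slice_le j (f : {set S} -> seq S -> R) U : T \subset U -> spherical m U ->
  #|U| = j ->
  (esum [set w | canon m U w]%classic (fun w => (f U w ^+ 2 * qw q w)%:E)
     <= wnorm2 m q T j f)%E.
Proof.
move=> TU sU cU.
rewrite -(@esum_image _ _ _ _ (fun w => (U, w))
  (fun c : {set S} * seq S => (f c.1 c.2 ^+ 2 * qw q c.2)%:E)); last first.
  by move=> w w' _ _ [].
apply: esum_subset => [_ [w cw <-] //|c].
by rewrite lee_fin mulr_ge0 ?sqr_ge0 // ltW.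
Qed.

(** At [x = a * v], with [a] shortest in its coset and [v] in [W_U], the summand is the contribution
    of the cell divided by [qG v]. As [U] is spherical, only finitely many [v] occur. *)
Lemma nrm_lift j (f : {set S} -> seq S -> R) U : T \subset U -> spherical m U ->
  #|U| = j -> L2chain m q T j f -> (nrm (lift f U) < +oo)%E.
Proof.
move=> TU sU cU hf; have /(sphericalP mP)[L hL] := sU.
pose r := undup (ball mP L).
pose e w := f U w ^+ 2 * qw q w.
have e0 w : 0 <= e w by rewrite mulr_ge0 ?sqr_ge0 // ltW.
pose psi v x := if x == (rep U x * v)%g then e (crp U x) else 0.
have psi0 v x : 0 <= psi v x by rewrite /psi; case: ifP.
have i0 v : 0 <= (qG v)^-1 by rewrite invr_ge0 ltW.
apply: (@le_lt_trans _ _ (es (fun x => \sum_(v <- r) (qG v)^-1 * psi v x))).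
  apply: le_es => x; pose v := ((rep U x)^-1 * x)%g.
  have Uv : inP U v by exact: rep_inPV.
  have vr : v \in r by rewrite mem_undup; apply: ballP; exact: hL.
  have xE : x = (rep U x * v)%g by rewrite /v mulVKg.
  rewrite (bigD1_seq v) ?undup_uniq //=; apply: ler_wpDr.
    by apply: sumr_ge0 => z _; rewrite mulr_ge0.
  rewrite /psi -xE eqxx {2}xE (qG_canon q_conj (@crp_canon _ _ mP U x) Uv).
  have ra : red mP (crp U x) by apply: canon_red; exact: crp_canon.
  rewrite -(qG_red q_conj ra) /lift /e !exprMn sqrr_sign mul1r.
  rewrite le_eqVlt; apply/orP; left; apply/eqP.
  have n1 : qw q (crp U x) != 0 by rewrite gt_eqF.
  have n2 : qG v != 0 by rewrite gt_eqF.
  by field; rewrite n1 n2.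
rewrite es_sum => [|v x]; last by rewrite mulr_ge0.
apply: lte_sum_pinfty => v _; apply: le_lt_trans (esZ_le (i0 v) (psi0 v)) _.
apply: lte_mul_pinfty; rewrite ?lee_fin //; apply: le_lt_trans hf.
apply: le_trans (slice_le f TU sU cU).
pose X := [set x | x = (rep U x * v)%g]%classic.
rewrite (@es_supp _ _ X); last by move=> x /= nx; rewrite /psi; case: eqP.
rewrite (@eq_esum _ _ _ _ (fun x => (e (crp U x))%:E)); last first.
  by move=> x /= xE; rewrite /psi -xE eqxx.
rewrite -(@esum_image _ _ _ X (fun x => crp U x) (fun w => (e w)%:E)).
  apply: esum_subset => [_ [x _ <-]|w]; last by rewrite lee_fin.
  exact: crp_canon.
move=> x y /set_mem /= xE /set_mem /= yE exy.
by rewrite xE yE /rep exy.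
Qed.

End Cells.

(** * Vanishing in degrees above the size of [T] *)

Section HomologyVanishing.
Variables (R : realType) (S : finType) (m : S -> S -> nat).
Variables (mP : coxeter_matrix m) (q : S -> R) (T : {set S}) (i : nat).
Local Notation G := (coxgroup mP).
Local Notation wd := (wd mP).
Local Notation gen := (gen mP).
Local Notation qG := (@qG R S m mP q).
Local Notation nrm := (@nrm R S m mP q).
Local Notation lift := (@lift R S m mP q).
Implicit Types (x y z : G) (s : S) (U V : {set S}) (w : seq S).
Hypothesis q_gt0 : forall s, (0 < q s)%R.
Hypothesis q_conj : forall s s' w, coxeq m (w ++ s :: rev w) [:: s'] -> q s = q s'.
Hypothesis Ti : (#|T| < i)%N.
Hypothesis reg : in_region m q (St m T).
Local Open Scope ring_scope.

(** This makes the push-forward for [V = St m T] preserve invariance under every [W_U] that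
    occurs. *)
Lemma sub_St U : T \subset U -> spherical m U -> U \subset St m T.
Proof.
move=> TU sU; apply/fintype.subsetP => s Us; rewrite inE; apply/asboolP.
by exists U; split=> //; rewrite (finset.setUidPl TU).
Qed.

Lemma L2H_vanishes_gt : L2H_vanishes m q T i.
Proof.
move=> f hf cyc e e0; pose V := St m T.
have qpos := @qG_gt0 R S m mP q q_gt0; have qwpos := @qw_gt0 R S q q_gt0.
have [A A0 AE] : exists2 A : R, 0 <= A &
    esum [set x : G | inP V x]%classic (fun x => (qG x)%:E) = A%:E.
  have := reg; rewrite /in_region (region_esum mP q_conj) -/V => h.
  have h0 : (0 <= esum [set x : G | inP V x]%classic (fun x => (qG x)%:E))%E.
    by apply: esum_ge0 => x _; rewrite lee_fin ltW.
  exists (fine (esum [set x : G | inP V x]%classic (fun x => (qG x)%:E))).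
    exact: fine_ge0.
  by rewrite fineK // ge0_fin_numE.
pose ok U := [&& T \subset U, #|U| == i & `[< spherical m U >]].
have okP U : ok U -> [/\ T \subset U, #|U| = i & spherical m U].
  by case/and3P=> ? /eqP ? /asboolP.
(* The lifted chain, extended by zero to types that carry no relative cell of degree [i]. *)
pose c U x := if ok U then lift f U x else 0.
have nc U : (nrm (c U) < +oo)%E.
  have [oU|oU] := boolP (ok U).
    have [TU cU sU] := okP _ oU.
    rewrite (_ : c U = lift f U); last by apply/funext => x; rewrite /c oU.
    exact: nrm_lift hf.
  by apply: (@nrm_finite _ _ _ mP _ q_gt0 _ 0%N) => x _; rewrite /c (negbTE oU).
have ci U s x : s \in U -> c U (x * gen s)%g = c U x.
  by move=> Us; rewrite /c lift_mulgen.
have bdc U x : T \subset U -> bd c U x = 0.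
  move=> TU.
  (* The cycle hypothesis speaks only of cells of degree [i.-1]. At any other [U] no coface is the
     type of an [i]-cell, and every term vanishes. *)
  have [cU|cU] := eqVneq #|U| i.-1; last first.
    rewrite /bd big1 // => s sU; rewrite /c.
    case: ifP => [/okP[_ h _]|_]; last by rewrite mulr0.
    by case/eqP: cU; rewrite -h cardsU1 sU.
  have [sU|sU] := pselect (spherical m U); last first.
    rewrite /bd big1 // => s _; rewrite /c.
    case: ifP => [/okP[_ _ h]|_]; last by rewrite mulr0.
    by case: sU; apply: (spherical_sub mP _ h); exact: finset.subsetUr.
  have cw := @crp_canon _ _ mP U x; set w := crp U x in cw.
  have := cyc (U, w); rewrite /= (dq_lift mP q f cw) => h.
  have {h} : (qw q w)^-1 * ((-1) ^+ size w *
      \sum_(s | (s \notin U) && `[< spherical m (s |: U) >])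
        eps R s (s |: U) * lift f (s |: U) (wd w)) = 0.
    by apply: h; [split | lia].
  move/eqP; rewrite mulf_eq0 invr_eq0 gt_eqF //= mulf_eq0 signr_eq0 /= => /eqP h.
  (* The hypothesis concerns the shortest element of [x W_U]; invariance carries it to [x]. *)
  have -> : bd c U x = bd c U (wd w).
    apply: eq_bigr => s _; congr (_ * _).
    rewrite -[x in LHS](mulVKg (wd w)).
    apply: (inv_inP (U := U)) => [t y Ut|]; first by apply: ci; rewrite !inE Ut orbT.
    exact: rep_inPV.
  rewrite -{}h /bd big_mkcondr /=; apply: eq_bigr => s sU'.
  rewrite /c /ok cardsU1 sU' cU add1n prednK; last lia.
  rewrite eqxx /= (fintype.subset_trans TU (finset.subsetUr _ _)) /=.
  by case: asboolP => _; rewrite ?mulr0.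
(* The error is distributed over all subsets of [S]; the added 1 makes the final inequality
   strict. *)
pose K : R := #|{set S}|%:R.
have K0 : 0 <= K by exact: ler0n.
pose d := e / (K + 1); have d0 : 0 < d by rewrite divr_gt0 //; lra.
have /all_sig[N hN] : forall U, {N | forall n, (N <= n)%N ->
    (nrm (fun x => push V n (c U) x - c U x)%R < d%:E)%E}.
  by move=> U; apply: cid; exact: (push_cvg q_gt0 q_conj A0 AE (nc U) d0).
pose n := \max_U N U.
have Nn U : (N U <= n)%N by exact: leq_bigmax.
pose c' U := push V n (c U).
have c'0 U x : ~~ ok U -> c' U x = 0.
  by move=> nU; apply: push0 => y; rewrite /c (negbTE nU).
have hc' : chain T i (n + size (ball mP n)).+1 c'.
  split.
  - move=> U x; have [/okP[]//|/c'0 ->] := boolP (ok U); by rewrite eqxx.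
  - move=> U s x Us; have [/okP[TU _ sU]|nU] := boolP (ok U); last by rewrite !c'0.
    have Vs : s \in V := fintype.subsetP (sub_St TU sU) _ Us.
    exact: (push_mulgen q_gt0 q_conj AE n x Vs (nc U) (fun y => ci U s y Us)).
  - move=> U x lx; apply/eqP; apply: contraTT lx => /push_len.
    by rewrite -leqNgt.
have bdc' U x : T \subset U -> bd c' U x = 0.
  move=> TU; apply: (push_sum q_gt0 q_conj AE) => [s|y]; first exact: nc.
  exact: bdc.
have [g [[sg ig lg] spg bdg]] := finite_exact Ti hc' bdc'.
(* The chain whose lift is [g]. *)
pose g' U w := (-1) ^+ size w * (qw q w)^-1 * g U (wd w).
have qGc U w : canon m U w -> qG (wd w) = qw q w.
  by move=> cw; rewrite (qG_red q_conj (canon_red mP cw)).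
exists g'; split.
  apply: (@le_lt_trans _ _ (\sum_(U : {set S}) nrm (g U))%E).
    apply: (wnorm2_le q_gt0) => U w [/= _ _ _ cw].
    rewrite (qGc _ _ cw) /g' !exprMn sqrr_sign mul1r.
    have nz : qw q w != 0 by rewrite gt_eqF.
    by field.
  apply: lte_sum_pinfty => U _; apply: (nrm_finite q_gt0) => x; exact: lg.
have liftg U x : lift g' U x = g U x.
  have ca := @crp_canon _ _ mP U x.
  have nz : qw q (crp U x) != 0 by rewrite gt_eqF.
  rewrite /lift /g' mulrA mulrACA divff // mulr1 -expr2 sqrr_sign mul1r.
  rewrite -[x in RHS](mulVKg (rep U x)); apply/esym.
  apply: (inv_inP (U := U)) => [s y Us|]; [exact: ig | exact: rep_inPV].
apply: (@le_lt_trans _ _ (\sum_(U : {set S}) nrm (fun x => c' U x - c U x)%R)%E).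
  apply: (wnorm2_le q_gt0) => U w [/= TU sU cU cw].
  have okU : ok U by rewrite /ok TU cU eqxx /=; apply/asboolP.
  have dE : dq m q g' U w = (qw q w)^-1 * ((-1) ^+ size w * c' U (wd w)).
    rewrite (dq_lift mP q g' cw) -bdg // /bd; congr (_ * (_ * _)).
    (* Restricting [dq] to spherical cofaces agrees with [bd], as [g] vanishes at the other
       types. *)
    rewrite big_mkcondr /=; apply: eq_bigr => s _; rewrite liftg.
    case: asboolP => // ns; have [->|/spg//] := eqVneq (g (s |: U) (wd w)) 0.
    by rewrite mulr0.
  have fE : f U w = (qw q w)^-1 * ((-1) ^+ size w * c U (wd w)).
    rewrite /c okU /lift (canon_crp mP cw) -(mulrA ((-1) ^+ _)).
    by rewrite (mulrA ((-1) ^+ _) ((-1) ^+ _)) -expr2 sqrr_sign mul1r mulKf // gt_eqF.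
  rewrite (qGc _ _ cw) dE fE -mulrBr -mulrBr !exprMn sqrr_sign mul1r.
  have nz : qw q w != 0 by rewrite gt_eqF.
  by field.
apply: (@le_lt_trans _ _ (\sum_(U : {set S}) d%:E)%E).
  by apply: lee_sum => U _; apply: ltW; exact: hN.
rewrite sumEFin lte_fin sumr_const -mulr_natr -/K /d.
by rewrite mulrAC ltr_pdivrMr; [nra | lra].
Qed.

End HomologyVanishing.

(** * Degrees below and above [k] *)

Local Open Scope classical_set_scope.
Local Open Scope ring_scope.

Theorem theorem4p3 (R : realType) (S : finType) (m : S -> S -> nat)
  (T : {set S}) (k : nat) (q : S -> R) :
  coxeter_matrix m ->
  spherical m T ->
  #|T| = k ->
  (forall s, 0 < q s) ->
  (forall (s s' : S) (w : seq S), coxeq m (w ++ s :: rev w) [:: s'] -> q s = q s') ->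
  in_region m q (St m T) ->
  forall i : nat, i != k -> L2H_vanishes m q T i.
Proof.
move=> mP _ <- q_gt0 q_conj reg i; rewrite neq_ltn => /orP[lt|]; last first.
  by move=> gt; apply: (L2H_vanishes_gt mP).
(* Below degree [k] there are no relative cells, since a type contains [T]; the zero chain
   serves. *)
move=> f _ _ e e0; exists (fun _ _ => 0); split.
  rewrite /L2chain /wnorm2 esum1 ?ltry // => c _.
  by rewrite expr0n mul0r.
rewrite /wnorm2 (_ : relcell m T i = set0) ?esum_set0 ?lte_fin //.
apply/seteqP; split=> // -[U w] [/= /subset_leq_card TU _ cU _].
by move: lt; rewrite ltnNge -cU TU.
Qed.
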